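(* Let the Löwner differential equation $$\frac{dh}{dt}=\frac{2}{h-\lambda(t)},\qquad h(z,0)\equiv z,$$ with a real-valued driving term $\lambda\in\mathrm{Lip}(1/2)$, $\|\lambda\|_{1/2}=c$, generate slit maps $h(z,t):\mathbb H\setminus\gamma(t)\to\mathbb H$, where $\gamma(t)$ is a quasislit. Let $h^+(\lambda(0),t)$ denote the right singular solution starting at $\lambda(0)$, so that $h^+(\lambda(0),0)=\lambda(0)$. Then $$\limsup_{t\to0+}\frac{h^+(\lambda(0),t)-h^+(\lambda(0),0)}{\sqrt t}\le\frac{c+\sqrt{c^2+16}}{2},$$ and this estimate is the best possible (that is, the right-hand side cannot be replaced by a smaller number depending only on $c$).
   Context: $\mathbb H=\{z\in\mathbb C:\operatorname{Im}z>0\}$. $\mathrm{Lip}(1/2)$ is the class of functions Hölder continuous with exponent $1/2$ on the time interval considered, and $\|\lambda\|_{1/2}$ is the smallest $C$ with $|\lambda(t)-\lambda(s)|\le C|t-s|^{1/2}$ for all $s,t$ in that interval. The equation generates slit maps if, for each $t>0$ in the time interval, $h(\cdot,t)$ maps $\mathbb H\setminus\gamma(t)$ conformally onto $\mathbb H$, where $\gamma(t)$ is a Jordan arc lying in $\mathbb H$ except for one endpoint, which is the point $\lambda(0)\in\mathbb R$. It is a quasislit if it is a quasiconformal image of an interval (a quasiarc) that lies within a Stolz angle at its endpoint on $\mathbb R$ (i.e. approaches $\mathbb R$ non-tangentially). Singular solutions: extend $h(\cdot,t)$ to the boundary of $\mathbb H\setminus\gamma(t)$. The (two-sided) arc $\gamma(t)$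 then corresponds to a segment $I(t)=[h^-(\lambda(0),t),h^+(\lambda(0),t)]\subset\mathbb R$, while $\mathbb R\setminus\{\lambda(0)\}$ corresponds to $\mathbb R\setminus I(t)$. The endpoints $h^{\pm}(\lambda(0),t)$ satisfy $h^{\pm}(\lambda(0),0)=\lambda(0)$, are continuous for $t\ge0$, are continuously differentiable solutions of the differential equation $\frac{dh}{dt}=\frac{2}{h-\lambda(t)}$ for $t>0$, and satisfy $h^-(\lambda(0),t)<\lambda(t)<h^+(\lambda(0),t)$ for $t>0$, with $h^-$ strictly decreasing and $h^+$ strictly increasing in $t$. They are called the singular solutions. *)

(* Defs.v *)
From Stdlib Require Import Reals.
From Coquelicot Require Import Coquelicot.

Open Scope R_scope.

(** * Upper limits *)

(* limsup_{t -> a+} f t = inf_{d > 0} sup_{a < t < a + d} f t *)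
Definition limsup_right (f : R -> R) (a : R) : Rbar :=
  Rbar_glb (fun u : Rbar => exists d : R, 0 < d /\
    u = Lub_Rbar (fun y : R => exists t : R, a < t < a + d /\ y = f t)).

(** * The driving term *)

(* A nondegenerate interval with left endpoint 0, containing 0: [0, T], [0, T)
   or [0, +oo). *)
Definition time_interval (J : R -> Prop) : Prop :=
  J 0 /\ (exists T : R, 0 < T /\ J T) /\
  (forall t : R, J t -> 0 <= t) /\
  (forall s t : R, J t -> 0 <= s <= t -> J s).

Definition half_holder_bound (J : R -> Prop) (lam : R -> R) (K : R) : Prop :=
  forall s t : R, J s -> J t -> Rabs (lam t - lam s) <= K * sqrt (Rabs (t - s)).

Definition Lip_half_norm (J : R -> Prop) (lam : R -> R) (c : R) : Prop :=
  half_holder_bound J lam c /\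
  (forall K : R, half_holder_bound J lam K -> c <= K).

(** * Slits *)

Definition upper_half_plane (z : C) : Prop := 0 < Im z.

Definition slit_domain (G : C -> Prop) (z : C) : Prop :=
  upper_half_plane z /\ ~ G z.

(* [G] is the trace of a Jordan arc which lies in the upper half-plane except
   for one endpoint, the real point [x0]. *)
Definition jordan_slit (x0 : R) (G : C -> Prop) : Prop :=
  exists p : R -> C,
    continuous_on (T := R_UniformSpace) (U := C_UniformSpace)
      (fun s : R => 0 <= s <= 1) p /\
    (forall s s' : R, 0 <= s <= 1 -> 0 <= s' <= 1 -> p s = p s' -> s = s') /\
    p 0 = RtoC x0 /\
    (forall s : R, 0 < s <= 1 -> upper_half_plane (p s)) /\
    (forall z : C, G z <-> exists s : R, 0 <= s <= 1 /\ z = p s).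

(** * Quasiconformal maps of the plane *)

Definition max_stretch (f : C -> C) (z : C) (r : R) : R :=
  real (Lub_Rbar (fun y : R => exists w : C,
    Cmod (w - z)%C = r /\ y = Cmod (f w - f z)%C)).

Definition min_stretch (f : C -> C) (z : C) (r : R) : R :=
  real (Glb_Rbar (fun y : R => exists w : C,
    Cmod (w - z)%C = r /\ y = Cmod (f w - f z)%C)).

Definition linear_dilatation (f : C -> C) (z : C) : Rbar :=
  limsup_right (fun r : R => max_stretch f z r / min_stretch f z r) 0.

Definition plane_homeomorphism (f : C -> C) : Prop :=
  (forall z : C, continuous (T := C_UniformSpace) (U := C_UniformSpace) f z) /\
  exists g : C -> C,
    (forall z : C,
       continuous (T := C_UniformSpace) (U := C_UniformSpace) g z) /\
    (forall z : C, g (f z) = z) /\ (forall z : C, f (g z) = z).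

(* The metric definition of quasiconformality. Sense-reversing maps are not
   excluded; this does not affect the class of images of real intervals, since
   one may precompose with complex conjugation. *)
Definition quasiconformal (f : C -> C) : Prop :=
  plane_homeomorphism f /\
  exists K : R, forall z : C, Rbar_le (linear_dilatation f z) (Finite K).

Definition quasiarc (G : C -> Prop) : Prop :=
  exists f : C -> C, quasiconformal f /\
    forall z : C, G z <-> exists s : R, 0 <= s <= 1 /\ z = f (RtoC s).

(* The angle of vertex [x0], symmetric about the vertical through [x0], of
   half-opening atan M < PI / 2. *)
Definition stolz_angle (x0 M : R) (z : C) : Prop :=
  upper_half_plane z /\ Rabs (Re z - x0) <= M * Im z.

Definition quasislit (x0 : R) (G : C -> Prop) : Prop :=
  jordan_slit x0 G /\ quasiarc G /\
  exists M : R, forall z : C, G z -> z <> RtoC x0 -> stolz_angle x0 M z.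

(** * The Loewner equation *)

(* [w] solves dw/ds = 2 / (w - lam s), w(0) = z, on [0, t]; the derivative is
   taken relative to [0, t], hence one-sided at the endpoints. *)
Definition loewner_solution (lam : R -> R) (z : C) (t : R) (w : R -> C)
  : Prop :=
  w 0 = z /\
  forall s : R, 0 <= s <= t ->
    w s <> RtoC (lam s) /\
    filterdiff (K := R_AbsRing) (U := R_NormedModule) (V := C_R_NormedModule)
      w (within (fun r : R => 0 <= r <= t) (locally s))
      (fun y : R => scal (V := C_R_NormedModule) y
                      (RtoC 2 / (w s - RtoC (lam s)))%C).

Definition conformal_onto (f : C -> C) (D E : C -> Prop) : Prop :=
  (forall z : C, D z -> ex_derive (K := C_AbsRing) (V := C_NormedModule) f z) /\
  (forall z z' : C, D z -> D z' -> f z = f z' -> z = z') /\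
  (forall z : C, D z -> E (f z)) /\
  (forall q : C, E q -> exists z : C, D z /\ f z = q).

(* [h z t] is only meaningful for [z] in the slit domain of [gam t]. *)
Definition generates_slit_maps (J : R -> Prop) (lam : R -> R)
  (h : C -> R -> C) (gam : R -> C -> Prop) : Prop :=
  forall t : R, J t -> 0 < t ->
    jordan_slit (lam 0) (gam t) /\
    (forall z : C, slit_domain (gam t) z -> loewner_solution lam z t (h z)) /\
    conformal_onto (fun z : C => h z t) (slit_domain (gam t)) upper_half_plane.

(** * Singular solutions *)

(* [q] is a value at the boundary point [p] of the extension of [f] to the
   (two-sided) boundary of [D]: it is a limit of [f] along some sequence of
   points of [D] converging to [p]. *)
Definition boundary_value (f : C -> C) (D : C -> Prop) (p q : C) : Prop :=
  forall eps : R, 0 < eps -> exists z : C,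
    D z /\ Cmod (z - p)%C < eps /\ Cmod (f z - q)%C < eps.

(* The real set I(t) corresponding to the two sides of the arc [gam t]. *)
Definition slit_image (h : C -> R -> C) (gam : R -> C -> Prop) (t x : R)
  : Prop :=
  exists p : C, gam t p /\
    boundary_value (fun z : C => h z t) (slit_domain (gam t)) p (RtoC x).

(* [hm] and [hp] are the left and right singular solutions h^-(lam 0, .) and
   h^+(lam 0, .): the endpoints of I(t). That they solve the Loewner equation,
   that they are monotone and that hm < lam < hp for t > 0 are consequences and
   are not part of the definition. *)
Definition singular_solutions (J : R -> Prop) (lam : R -> R)
  (h : C -> R -> C) (gam : R -> C -> Prop) (hm hp : R -> R) : Prop :=
  hm 0 = lam 0 /\ hp 0 = lam 0 /\
  forall t : R, J t -> 0 < t ->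
    hm t < hp t /\
    forall x : R, slit_image h gam t x <-> hm t <= x <= hp t.

(* limsup_{t -> 0+} (h^+(lam 0, t) - h^+(lam 0, 0)) / sqrt t <= B for every
   driving term of Lip(1/2)-norm [c] that generates quasislits. *)
Definition singular_growth_bound (J : R -> Prop) (c B : R) : Prop :=
  forall (lam : R -> R) (h : C -> R -> C) (gam : R -> C -> Prop)
    (hm hp : R -> R),
    Lip_half_norm J lam c ->
    generates_slit_maps J lam h gam ->
    (forall t : R, J t -> 0 < t -> quasislit (lam 0) (gam t)) ->
    singular_solutions J lam h gam hm hp ->
    Rbar_le (limsup_right (fun t : R => (hp t - hp 0) / sqrt t) 0) (Finite B).

(* Main.v *)
Require Import Defs.
From Stdlib Require Import Reals Lra Psatz Classical ClassicalEpsilon.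
From Coquelicot Require Import Coquelicot.

Open Scope R_scope.

(** Put [A = (c + sqrt (c ^ 2 + 16)) / 2], so that [A * (A - c) = 4].

    Upper bound. [A * sqrt s] solves the equation driven by [c * sqrt s], which
    dominates [lam s - lam 0]. If a point [x > lam 0 + A * sqrt t] belonged to
    the slit image at time [t], run the flow backwards from points of the
    half-plane close to [x]: they stay to the right of [lam 0 + A * sqrt s],
    at a fixed distance from [lam s], so that their imaginary parts stay small
    and they end near a real point other than [lam 0]. No point of the slit
    is of that kind.

    Sharpness. For [lam s = c * sqrt s], with [A > 0 > B] the roots of
    [u ^ 2 - c * u = 4], the flow is given implicitly by
    [(h - A * sqrt t) ^ al * (h - B * sqrt t) ^ (1 - al) = z], where
    [al = - B / (A - B)]. It generates straight segments of angle [PI * al], and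
    the slit image at time [t] is the interval from [B * sqrt t] to [A * sqrt t]. *)

(** The equation is singular at its start for the solution issuing from [lam 0], and [hp] is given
    only as an end of the slit image, with no equation attached. Points inside the half-plane close
    to [hp t] avoid both difficulties: their backward trajectories are regular up to time 0.

    For the extremal driving term no existence theorem for the flow is used: [h] is recovered from
    its implicit equation. Logarithms replace the real powers because a weighted mean of two
    arguments in [(0, PI)] stays in [(0, PI)], so no branch has to be chosen. One quantitative
    injectivity estimate, uniform in the parameters, then yields both the injectivity of the
    implicit equation and the continuity of its solution in [z] and in [t]. The weight [al] is the
    one with [al * A + (1 - al) * B = 0]; together with [A * B = - 4] this turns the implicit
    derivative into the Loewner velocity. Time 0, where [sqrt] has no derivative, needs a separate
    argument.

    The slit image must be identified exactly. One inclusion is the upper bound applied to both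
    ends; the other comes from approaching each real point vertically. *)

Lemma Im_abs_le (z : C) : Rabs (Im z) <= Cmod z.
Proof. exact (Rle_trans _ _ _ (Rmax_r _ _) (Rmax_Cmod z)). Qed.

Lemma Cmod_le_Re_Im (z : C) : Cmod z <= Rabs (Re z) + Rabs (Im z).
Proof.
  apply Rsqr_incr_0_var.
  - assert (H := Cmod2_alt z). unfold Rsqr.
    assert (Ha := Rabs_pos (Re z)). assert (Hb := Rabs_pos (Im z)).
    assert (Ea := pow2_abs (Re z)). assert (Eb := pow2_abs (Im z)). nra.
  - assert (Ha := Rabs_pos (Re z)). assert (Hb := Rabs_pos (Im z)). lra.
Qed.

Lemma mean_value (f df : R -> R) (a b : R) : a < b ->
  (forall x, a <= x <= b -> continuity_pt f x) ->
  (forall x, a < x < b -> is_derive f x (df x)) ->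
  exists x, a < x < b /\ f b - f a = df x * (b - a).
Proof.
  intros Hab Hc Hd.
  assert (pr : forall x, a < x < b -> derivable_pt f x).
  { intros x Hx. exists (df x). apply is_derive_Reals, Hd, Hx. }
  assert (pr2 : forall x, a < x < b -> derivable_pt id x).
  { intros x _. apply derivable_pt_id. }
  destruct (MVT f id a b pr pr2 Hab Hc) as [x [P E]].
  { intros x _. apply derivable_continuous_pt, derivable_pt_id. }
  exists x. split; [exact P|].
  rewrite (derive_pt_eq_0 f x (df x)) in E by now apply is_derive_Reals, Hd.
  rewrite (derive_pt_eq_0 id x 1) in E by apply derivable_pt_lim_id.
  unfold id in E. lra.
Qed.

(** An epsilon-delta form of the one-sided derivative, used in both directions: to read off a given
    solution and to certify the explicit one. *)
Lemma filterdiff_path_iff (t s : R) (w : R -> C) (D : C) : 0 <= s <= t ->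
  filterdiff (K := R_AbsRing) (U := R_NormedModule) (V := C_R_NormedModule)
    w (within (fun r : R => 0 <= r <= t) (locally s))
    (fun y : R => scal (V := C_R_NormedModule) y D) <->
  (forall eps, 0 < eps -> exists del, 0 < del /\
     forall r, 0 <= r <= t -> Rabs (r - s) < del ->
     Cmod (w r - w s - RtoC (r - s) * D)%C <= eps * Rabs (r - s)).
Proof.
  intros Hs.
  assert (EC : forall r, norm (K := R_AbsRing) (V := C_R_NormedModule)
     (minus (minus (w r) (w s)) (scal (V := C_R_NormedModule) (minus r s) D))
     = Cmod (w r - w s - RtoC (r - s) * D)%C).
  { intros r. rewrite Cmod_norm. f_equal.
    destruct (w r) as [a b], (w s) as [a' b'], D as [p q].
    apply injective_projections; cbn; unfold mult; cbn; ring. }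
  split.
  - intros [_ H] eps He.
    assert (Hl : is_filter_lim (T := R_UniformSpace)
        (within (fun r : R => 0 <= r <= t) (locally s)) s).
    { intros P HP. unfold within. revert HP. apply filter_imp. tauto. }
    destruct (H s Hl (mkposreal eps He)) as [del Hd].
    exists del. split; [apply cond_pos|]. intros r Hr Hrs.
    rewrite <- EC. exact (Hd r Hrs Hr).
  - intros H. split.
    + apply (is_linear_scal_l (K := R_AbsRing) (V := C_R_NormedModule)).
    (* [filterdiff] quantifies over all limits of the filter; by separation [s] is the only one. *)
    + intros x Hx. assert (x = s) as ->.
      { apply Rminus_diag_uniq. destruct (Req_dec (x - s) 0) as [E|E]; [exact E|].
        exfalso. assert (Hp : 0 < Rabs (x - s)) by now apply Rabs_pos_lt.
        destruct (Hx (ball x (mkposreal _ Hp)) (locally_ball _ _)) as [d Hd].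
        specialize (Hd s (ball_center _ _) Hs).
        change (Rabs (s - x) < Rabs (x - s)) in Hd.
        rewrite Rabs_minus_sym in Hd. lra. }
      intros eps. destruct (H eps (cond_pos eps)) as [d [Hd H']].
      exists (mkposreal d Hd). intros r Hr Hr'.
      specialize (H' r Hr' Hr). rewrite <- EC in H'. exact H'.
Qed.

(** The supremum of the set where [g <= k] works. It provides an interval on which [g] exceeds [k]
    throughout, so that a derivative estimate valid only above level [k] can be used there. *)
Lemma last_crossing (g : R -> R) (a b k : R) : a < b ->
  (forall x, a <= x <= b -> continuity_pt g x) -> g a < k < g b ->
  exists x, a <= x < b /\ g x <= k /\ forall y, x < y <= b -> k < g y.
Proof.
  intros Hab Hc Hk.
  destruct (completeness (fun x => a <= x <= b /\ g x <= k)) as [m [Hub Hl]].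
  - exists b. intros x [Hx _]. apply Hx.
  - exists a. lra.
  - assert (Ham : a <= m) by (apply Hub; lra).
    assert (Hmb : m <= b) by (apply Hl; intros x [Hx _]; apply Hx).
    assert (Hgm : g m <= k).
    { destruct (Rle_or_lt (g m) k) as [H|H]; [exact H|exfalso].
      assert (He : 0 < g m - k) by lra.
      destruct (proj1 (continuity_pt_locally g m) (Hc m (conj Ham Hmb))
                  (mkposreal _ He)) as [d Hd]. simpl in Hd.
      assert (Hmd : m <= m - d / 2).
      { apply Hl. intros x [Hx Hgx].
        destruct (Rle_or_lt x (m - d / 2)) as [H1|H1]; [exact H1|exfalso].
        assert (x <= m) by (apply Hub; tauto).
        assert (Hb : ball m d x).
        { change (Rabs (x - m) < d). apply Rabs_def1; destruct d; simpl in *; lra. }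
        specialize (Hd x Hb). apply Rabs_def2 in Hd. lra. }
      destruct d; simpl in *; lra. }
    exists m. split; [|split; [exact Hgm|]].
    + split; [exact Ham|]. destruct Hmb as [|E]; [easy|]. subst; lra.
    + intros y Hy. destruct (Rle_or_lt (g y) k) as [H|H]; [|exact H].
      assert (y <= m) by (apply Hub; split; [lra|exact H]). lra.
Qed.

(** * Reverse Loewner flow *)

(* [A] is the larger root of [A ^ 2 - c * A = 4], so that [A * sqrt s] solves
   the equation driven by [c * sqrt s]: a solution ahead of it drifts away from
   it when time runs backwards. *)
Lemma reverse_flow_barrier (A c t d : R) (lam u v : R -> R) :
  0 < t -> 0 < d -> 0 < A -> A * (A - c) = 4 ->
  (forall s, 0 <= s <= t -> lam s <= c * sqrt s) ->
  continuity u -> continuity v ->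
  (forall s, 0 < s < t ->
     is_derive u s (2 * (u s - lam s) / ((u s - lam s) ^ 2 + v s ^ 2)) /\
     is_derive v s (- 2 * v s / ((u s - lam s) ^ 2 + v s ^ 2))) ->
  A * sqrt t + d <= u t ->
  d <= u 0 /\ v 0 ^ 2 <= exp (4 * t / d ^ 2) * v t ^ 2.
Proof.
  intros Ht Hd HA HAc Hlam Cu Cv Hder Hut.
  assert (HAc' : 0 < A - c) by nra.
  assert (Hcg : forall x, continuity_pt (fun s => u s - A * sqrt s) x).
  { intros x. apply continuity_pt_filterlim.
    apply (continuous_minus (K := R_AbsRing) (V := R_NormedModule) u (fun s => A * sqrt s)).
    - apply continuity_pt_filterlim, Cu.
    - apply (continuous_scal_r (K := R_AbsRing) (V := R_NormedModule) A sqrt).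
      apply continuous_sqrt. }
  assert (Hg : forall s, 0 <= s <= t -> d <= u s - A * sqrt s).
  { intros s0 Hs0. destruct (Rle_or_lt d (u s0 - A * sqrt s0)) as [H|H]; [exact H|exfalso].
    (* A level strictly between the assumed low value and [d], and positive: above it [u] stays to
       the right of [A * sqrt s], hence of [lam s]. *)
    set (k := (Rmax (u s0 - A * sqrt s0) 0 + d) / 2).
    assert (Hk : 0 < k /\ u s0 - A * sqrt s0 < k /\ k < d).
    { unfold k. assert (H1 := Rmax_l (u s0 - A * sqrt s0) 0).
      assert (H2 := Rmax_r (u s0 - A * sqrt s0) 0).
      assert (H3 : Rmax (u s0 - A * sqrt s0) 0 < d) by now apply Rmax_lub_lt.
      lra. }
    assert (Hst : s0 < t). { destruct (proj2 Hs0) as [|E]; [easy|subst; lra]. }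
    destruct (last_crossing (fun s => u s - A * sqrt s) s0 t k Hst) as [x [Hx [Hgx Hy]]].
    { intros; apply Hcg. }
    { lra. }
    destruct (mean_value (fun s => u s - A * sqrt s)
      (fun s => 2 * (u s - lam s) / ((u s - lam s) ^ 2 + v s ^ 2) - A * / (2 * sqrt s)) x t)
      as [y [Hy1 E]].
    { lra. }
    { intros; apply Hcg. }
    { intros y Hy1. apply (is_derive_minus (K := R_AbsRing) (V := R_NormedModule) u (fun s => A * sqrt s)).
      - apply Hder. lra.
      - auto_derive; [lra|]. field. apply Rgt_not_eq, sqrt_lt_R0. lra. }
    assert (Hsq : 0 < sqrt y) by (apply sqrt_lt_R0; lra).
    assert (Hky : k < u y - A * sqrt y) by (apply Hy; lra).
    assert (Hl : lam y <= c * sqrt y) by (apply Hlam; lra).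
    assert (Hp : (A - c) * sqrt y < u y - lam y) by nra.
    assert (Hp0 : 0 < (A - c) * sqrt y) by nra.
    (* Dropping [v ^ 2] only raises the speed, and [2 / (A - c) = A / 2] matches the derivative of
       [A * sqrt s]. So the difference has negative slope at [y], although it rises from at most [k]
       at [x] to at least [d] at [t]. *)
    assert (2 * (u y - lam y) / ((u y - lam y) ^ 2 + v y ^ 2) <= 2 / (u y - lam y)).
    { apply Rle_div_l; [nra|].
      replace (2 / (u y - lam y) * ((u y - lam y) ^ 2 + v y ^ 2)) with
        (2 * (u y - lam y) + 2 * v y ^ 2 / (u y - lam y)) by (field; lra).
      assert (0 <= 2 * v y ^ 2 / (u y - lam y)).
      { apply Rdiv_le_0_compat; nra. }
      lra. }
    assert (2 / (u y - lam y) < 2 / ((A - c) * sqrt y)).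
    { apply Rmult_lt_compat_l; [lra|]. apply Rinv_lt_contravar; nra. }
    assert (E2 : 2 / ((A - c) * sqrt y) = A * / (2 * sqrt y)).
    { field_simplify_eq; [nra|lra]. }
    nra. }
  split.
  { specialize (Hg 0). rewrite sqrt_0 in Hg. lra. }
  (* Since [u - lam >= d], the derivative of [v ^ 2] is at least [- 4 * v ^ 2 / d ^ 2]; the
     exponential is the integrating factor that makes the product nondecreasing. *)
  destruct (mean_value (fun s => exp (4 * s / d ^ 2) * v s ^ 2)
     (fun s => 4 / d ^ 2 * exp (4 * s / d ^ 2) * v s ^ 2 +
        exp (4 * s / d ^ 2) * (2 * v s * (- 2 * v s / ((u s - lam s) ^ 2 + v s ^ 2)))) 0 t)
    as [y [Hy E]].
  { exact Ht. }
  { intros x _. apply continuity_pt_mult.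
    - apply derivable_continuous_pt. apply ex_derive_Reals_0. auto_derive. nra.
    - apply continuity_pt_mult; [apply Cv|]. apply continuity_pt_mult; [apply Cv|].
      apply continuity_const. intros ? ?; reflexivity. }
  { intros x Hx. destruct (Hder x Hx) as [_ Hv].
    evar_last.
    - apply (is_derive_mult (fun s => exp (4 * s / d ^ 2)) (fun s => v s ^ 2)).
      + auto_derive; [nra|reflexivity].
      + apply (is_derive_pow v 2 x _ Hv).
      + intros; apply Rmult_comm.
    - unfold plus, mult, Rdiv; simpl. field. split; [|lra].
      assert (0 < (u x - lam x) * ((u x - lam x) * 1) + v x * (v x * 1)); [|lra].
      specialize (Hg x). specialize (Hlam x). assert (0 < sqrt x) by (apply sqrt_lt_R0; lra).
      assert (0 < u x - lam x) by nra. nra. }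
  assert (Hux : d <= u y - lam y).
  { specialize (Hg y). specialize (Hlam y). assert (0 < sqrt y) by (apply sqrt_lt_R0; lra). nra. }
  assert (Hden : d ^ 2 <= (u y - lam y) ^ 2 + v y ^ 2) by nra.
  assert (Hd2 : 0 < d ^ 2) by nra.
  assert (Hinv : / ((u y - lam y) ^ 2 + v y ^ 2) <= / d ^ 2) by now apply Rinv_le_contravar.
  assert (Hv2 : 0 <= v y ^ 2) by nra.
  assert (He := exp_pos (4 * y / d ^ 2)).
  assert (E0 : 4 * 0 / d ^ 2 = 0) by (field; lra).
  rewrite E0, exp_0 in E.
  assert (0 <= exp (4 * t / d ^ 2) * v t ^ 2 - 1 * v 0 ^ 2); [|lra].
  rewrite E. apply Rmult_le_pos; [|lra].
  replace (4 / d ^ 2 * exp (4 * y / d ^ 2) * v y ^ 2 +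
     exp (4 * y / d ^ 2) * (2 * v y * (- 2 * v y / ((u y - lam y) ^ 2 + v y ^ 2))))
   with (4 * exp (4 * y / d ^ 2) * v y ^ 2 * (/ d ^ 2 - / ((u y - lam y) ^ 2 + v y ^ 2)))
   by (field; lra).
  apply Rmult_le_pos; [|lra]. apply Rmult_le_pos; [lra|exact Hv2].
Qed.

(** Clamping time to [[0, t]] is 1-Lipschitz, so it preserves continuity, and it changes nothing
    near interior points. The result suits mean value arguments that ask for two-sided continuity at
    the endpoints. *)
Lemma extend_path_component (t : R) (f D : R -> R) : 0 < t ->
  (forall s, 0 <= s <= t -> forall eps, 0 < eps -> exists del, 0 < del /\
     forall r, 0 <= r <= t -> Rabs (r - s) < del -> Rabs (f r - f s) < eps) ->
  (forall s, 0 < s < t -> forall eps, 0 < eps -> exists del, 0 < del /\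
     forall r, 0 <= r <= t -> Rabs (r - s) < del ->
     Rabs (f r - f s - (r - s) * D s) <= eps * Rabs (r - s)) ->
  exists u : R -> R, (forall s, 0 <= s <= t -> u s = f s) /\ continuity u /\
    forall s, 0 < s < t -> is_derive u s (D s).
Proof.
  intros Ht Hc H.
  pose (cl := fun s => Rmax 0 (Rmin s t)).
  assert (Hcl : forall s, 0 <= cl s <= t).
  { intros s. unfold cl, Rmax, Rmin. repeat destruct Rle_dec; lra. }
  assert (Hcl1 : forall r s, Rabs (cl r - cl s) <= Rabs (r - s)).
  { intros r s. unfold cl, Rmax, Rmin, Rabs.
    repeat destruct Rle_dec; repeat destruct Rcase_abs; lra. }
  assert (Hid : forall s, 0 <= s <= t -> cl s = s).
  { intros s Hs. unfold cl, Rmax, Rmin. repeat destruct Rle_dec; lra. }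
  exists (fun s => f (cl s)). split; [|split].
  - intros s Hs. now rewrite Hid.
  - intros s. apply continuity_pt_locally. intros eps.
    destruct (Hc (cl s) (Hcl s) eps (cond_pos eps)) as [d [Hd H']].
    exists (mkposreal d Hd). intros r Hr. change (Rabs (r - s) < d) in Hr.
    apply H'; [apply Hcl|]. eapply Rle_lt_trans; [apply Hcl1|exact Hr].
  - intros s Hs. apply is_derive_Reals. intros eps He.
    destruct (H s Hs (eps / 2) ltac:(lra)) as [d [Hd H']].
    assert (Hm : 0 < Rmin d (Rmin s (t - s))) by (repeat apply Rmin_glb_lt; lra).
    exists (mkposreal _ Hm). intros h Hh0 Hh. simpl in Hh.
    assert (Hh1 : Rabs h < d) by (eapply Rlt_le_trans; [exact Hh|apply Rmin_l]).
    assert (Hh2 : Rabs h < s /\ Rabs h < t - s).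
    { split; (eapply Rlt_le_trans; [exact Hh|]); (eapply Rle_trans; [apply Rmin_r|]);
        [apply Rmin_l|apply Rmin_r]. }
    destruct Hh2 as [Hh2 Hh3]. apply Rabs_def2 in Hh2. apply Rabs_def2 in Hh3.
    rewrite !Hid by lra.
    specialize (H' (s + h)). replace (s + h - s) with h in H' by ring.
    specialize (H' ltac:(lra) Hh1).
    replace ((f (s + h) - f s) / h - D s) with ((f (s + h) - f s - h * D s) / h)
      by (field; exact Hh0).
    assert (Hp : 0 < Rabs h) by now apply Rabs_pos_lt.
    unfold Rdiv. rewrite Rabs_mult, Rabs_inv.
    apply (Rle_lt_trans _ (eps / 2 * Rabs h * / Rabs h)).
    + apply Rmult_le_compat_r; [|exact H']. left. now apply Rinv_0_lt_compat.
    + rewrite Rmult_assoc, Rinv_r; lra.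
Qed.

Lemma within_differentiable_continuous (t s D : R) (f : R -> R) :
  (forall eps, 0 < eps -> exists del, 0 < del /\
     forall r, 0 <= r <= t -> Rabs (r - s) < del ->
     Rabs (f r - f s - (r - s) * D) <= eps * Rabs (r - s)) ->
  forall eps, 0 < eps -> exists del, 0 < del /\
     forall r, 0 <= r <= t -> Rabs (r - s) < del -> Rabs (f r - f s) < eps.
Proof.
  intros H eps He. destruct (H 1 Rlt_0_1) as [d [Hd H']].
  set (K := 1 + Rabs D).
  assert (HK : 0 < K) by (unfold K; assert (Q := Rabs_pos D); lra).
  exists (Rmin d (eps / K)). split.
  { apply Rmin_glb_lt; [exact Hd|]. now apply Rdiv_lt_0_compat. }
  intros r Hr Hrs.
  assert (Hr1 : Rabs (r - s) < d) by (eapply Rlt_le_trans; [exact Hrs|apply Rmin_l]).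
  assert (Hr2 : Rabs (r - s) < eps / K) by (eapply Rlt_le_trans; [exact Hrs|apply Rmin_r]).
  specialize (H' r Hr Hr1).
  replace (f r - f s) with ((f r - f s - (r - s) * D) + (r - s) * D) by ring.
  eapply Rle_lt_trans; [apply Rabs_triang|]. rewrite Rabs_mult.
  apply (Rle_lt_trans _ (K * Rabs (r - s))); [unfold K; lra|].
  apply Rlt_div_r in Hr2; [lra|exact HK].
Qed.

Lemma loewner_velocity (w : C) (l : R) : w <> RtoC l ->
  Re (RtoC 2 / (w - RtoC l))%C = 2 * (Re w - l) / ((Re w - l) ^ 2 + Im w ^ 2) /\
  Im (RtoC 2 / (w - RtoC l))%C = - 2 * Im w / ((Re w - l) ^ 2 + Im w ^ 2).
Proof.
  intros H. destruct w as [x y]. cbn.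
  assert (0 < (x - l) ^ 2 + y ^ 2).
  { destruct (Req_dec y 0) as [E|E].
    - assert (Hx : x - l <> 0).
      { intros E'. apply H. rewrite E, (Rminus_diag_uniq _ _ E'). reflexivity. }
      apply pow2_gt_0 in Hx. assert (P := pow2_ge_0 y). lra.
    - apply pow2_gt_0 in E. assert (P := pow2_ge_0 (x - l)). lra. }
  split; field; apply Rgt_not_eq; cbn in *; lra.
Qed.

Lemma loewner_components (lam : R -> R) (z : C) (t : R) (w : R -> C) : 0 < t ->
  loewner_solution lam z t w ->
  exists u v : R -> R,
    (forall s, 0 <= s <= t -> u s = Re (w s) /\ v s = Im (w s)) /\
    continuity u /\ continuity v /\
    forall s, 0 < s < t ->
     is_derive u s (2 * (u s - lam s) / ((u s - lam s) ^ 2 + v s ^ 2)) /\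
     is_derive v s (- 2 * v s / ((u s - lam s) ^ 2 + v s ^ 2)).
Proof.
  intros Ht [_ H].
  assert (HC : forall s r D, Re (w r - w s - RtoC (r - s) * D)%C =
      Re (w r) - Re (w s) - (r - s) * Re D /\
      Im (w r - w s - RtoC (r - s) * D)%C = Im (w r) - Im (w s) - (r - s) * Im D).
  { intros s r D. destruct (w r), (w s), D. cbn. split; ring. }
  assert (HD : forall s, 0 <= s <= t -> forall eps, 0 < eps -> exists del, 0 < del /\
     forall r, 0 <= r <= t -> Rabs (r - s) < del ->
     Cmod (w r - w s - RtoC (r - s) * (RtoC 2 / (w s - RtoC (lam s))))%C <= eps * Rabs (r - s)).
  { intros s Hs. apply filterdiff_path_iff; [exact Hs|]. now apply H. }
  assert (HR : forall s, 0 <= s <= t -> forall eps, 0 < eps -> exists del, 0 < del /\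
     forall r, 0 <= r <= t -> Rabs (r - s) < del ->
     Rabs (Re (w r) - Re (w s) - (r - s) * Re (RtoC 2 / (w s - RtoC (lam s)))%C)
       <= eps * Rabs (r - s)).
  { intros s Hs eps He. destruct (HD s Hs eps He) as [d [Hd H']].
    exists d. split; [exact Hd|]. intros r Hr Hrs. rewrite <- (proj1 (HC s r _)).
    eapply Rle_trans; [apply re_le_Cmod|]. now apply H'. }
  assert (HI : forall s, 0 <= s <= t -> forall eps, 0 < eps -> exists del, 0 < del /\
     forall r, 0 <= r <= t -> Rabs (r - s) < del ->
     Rabs (Im (w r) - Im (w s) - (r - s) * Im (RtoC 2 / (w s - RtoC (lam s)))%C)
       <= eps * Rabs (r - s)).
  { intros s Hs eps He. destruct (HD s Hs eps He) as [d [Hd H']].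
    exists d. split; [exact Hd|]. intros r Hr Hrs. rewrite <- (proj2 (HC s r _)).
    eapply Rle_trans; [apply Im_abs_le|]. now apply H'. }
  destruct (extend_path_component t (fun s => Re (w s))
     (fun s => Re (RtoC 2 / (w s - RtoC (lam s)))%C) Ht) as [u [Eu [Cu Du]]].
  { intros s Hs. apply (within_differentiable_continuous t s _ (fun s => Re (w s)) (HR s Hs)). }
  { intros s Hs. apply HR. lra. }
  destruct (extend_path_component t (fun s => Im (w s))
     (fun s => Im (RtoC 2 / (w s - RtoC (lam s)))%C) Ht) as [v [Ev [Cv Dv]]].
  { intros s Hs. apply (within_differentiable_continuous t s _ (fun s => Im (w s)) (HI s Hs)). }
  { intros s Hs. apply HI. lra. }
  exists u, v. split; [|split; [|split]]; auto.
  intros s Hs. specialize (Du s Hs). specialize (Dv s Hs).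
  rewrite Eu, Ev by lra.
  destruct (H s ltac:(lra)) as [Hne _].
  destruct (loewner_velocity (w s) (lam s) Hne) as [E1 E2].
  rewrite E1 in Du. rewrite E2 in Dv. split; assumption.
Qed.

(* [sg = -1] is the reflected statement, for the left end of the slit image. *)
Lemma slit_image_bound (sg A c t : R) (lam : R -> R) (h : C -> R -> C)
  (gam : R -> C -> Prop) (x : R) :
  sg ^ 2 = 1 -> 0 < t -> 0 < A -> A * (A - c) = 4 ->
  (forall s, 0 <= s <= t -> sg * (lam s - lam 0) <= c * sqrt s) ->
  jordan_slit (lam 0) (gam t) ->
  (forall z : C, slit_domain (gam t) z -> loewner_solution lam z t (h z)) ->
  slit_image h gam t x -> sg * (x - lam 0) <= A * sqrt t.
Proof.
  intros Hsg Ht HA HAc Hlam Hj Hsol [p [Hp Hb]].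
  destruct (Rle_or_lt (sg * (x - lam 0)) (A * sqrt t)) as [H|H]; [exact H|exfalso].
  set (d := (sg * (x - lam 0) - A * sqrt t) / 2).
  assert (Hd : 0 < d) by (unfold d; lra).
  assert (Hsg1 : Rabs sg = 1).
  { assert (E := pow2_abs sg). assert (P := Rabs_pos sg). nra. }
  assert (Hsga : forall y, Rabs (sg * y) = Rabs y).
  { intros y. rewrite Rabs_mult, Hsg1. ring. }
  set (K := exp (4 * t / d ^ 2)).
  assert (HK : 0 < K) by apply exp_pos.
  (* A boundary value supplies [z] near [p] with [h z t] near [x]. The backward trajectory from
     [h z t] ends at [z], which is therefore nearly real and horizontally at least [d] away from
     [lam 0]. *)
  assert (Key : forall eps, 0 < eps < d -> exists z : C, Cmod (z - p)%C < eps /\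
     d <= sg * (Re z - lam 0) /\ Im z ^ 2 <= K * eps ^ 2).
  { intros eps He. destruct (Hb eps (proj1 He)) as [z [Hz [Hzp Hzx]]].
    exists z. split; [exact Hzp|].
    assert (Hs := Hsol z Hz).
    destruct (loewner_components lam z t (h z) Ht Hs) as [u [v [Euv [Cu [Cv Duv]]]]].
    destruct (reverse_flow_barrier A c t d (fun s => sg * (lam s - lam 0))
      (fun s => sg * (u s - lam 0)) v) as [H1 H2]; auto.
    - apply continuity_mult; [apply continuity_const; intros ? ?; reflexivity|].
      apply continuity_minus; [exact Cu|apply continuity_const; intros ? ?; reflexivity].
    - intros s Hst. destruct (Duv s Hst) as [D1 D2].
      replace (sg * (u s - lam 0) - sg * (lam s - lam 0)) with (sg * (u s - lam s)) by ring.
      replace ((sg * (u s - lam s)) ^ 2) with ((u s - lam s) ^ 2)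
        by (transitivity (sg ^ 2 * (u s - lam s) ^ 2); [rewrite Hsg; ring|ring]).
      split; [|exact D2].
      evar_last.
      + apply (is_derive_scal (fun s => u s - lam 0) s sg).
        apply (is_derive_minus (K := R_AbsRing) (V := R_NormedModule) u (fun _ => lam 0)).
        * exact D1.
        * apply (is_derive_const (K := R_AbsRing) (V := R_NormedModule)).
      + unfold minus, plus, opp, zero; simpl. unfold Rdiv. ring.
    - destruct (Euv t ltac:(lra)) as [E1 _]. rewrite E1.
      assert (Hre : Rabs (sg * (Re (h z t) - x)) < eps).
      { rewrite Hsga. eapply Rle_lt_trans; [|exact Hzx].
        replace (Re (h z t) - x) with (Re (h z t - RtoC x)%C)
          by (destruct (h z t); cbn; ring).
        apply re_le_Cmod. }
      apply Rabs_def2 in Hre. unfold d in *. lra.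
    - destruct (Euv 0 ltac:(lra)) as [E1 E2]. rewrite (proj1 Hs) in E1, E2.
      cbn beta in H1. rewrite E1 in H1. rewrite E2 in H2.
      split; [exact H1|]. eapply Rle_trans; [exact H2|].
      fold K. apply Rmult_le_compat_l; [lra|].
      destruct (Euv t ltac:(lra)) as [_ E3]. rewrite E3.
      assert (Him : Rabs (Im (h z t)) < eps).
      { eapply Rle_lt_trans; [|exact Hzx].
        replace (Im (h z t)) with (Im (h z t - RtoC x)%C)
          by (destruct (h z t); cbn; ring).
        apply Im_abs_le. }
      apply Rabs_def2 in Him. nra. }
  destruct Hj as [q [_ [_ [Hq0 [Hqi Hqg]]]]].
  apply Hqg in Hp. destruct Hp as [s [Hs Ep]].
  destruct (Rle_lt_or_eq_dec 0 s (proj1 Hs)) as [Hs0|Hs0].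
  - assert (Hi : 0 < Im p) by (rewrite Ep; apply Hqi; lra).
    (* With this [eps], closeness to [p] forces [Im z > (1 + 2 * K) * eps], against
       [Im z ^ 2 <= K * eps ^ 2]. *)
    set (eps := Rmin (d / 2) (Im p / (2 * (1 + K)))).
    assert (He1 : 0 < eps).
    { apply Rmin_glb_lt; [lra|]. apply Rdiv_lt_0_compat; lra. }
    assert (He2 : eps <= d / 2) by apply Rmin_l.
    assert (He3 : eps <= Im p / (2 * (1 + K))) by apply Rmin_r.
    apply Rle_div_r in He3; [|lra].
    destruct (Key eps ltac:(lra)) as [z [Hz [_ Hzi]]].
    assert (Hre : Rabs (Im z - Im p) < eps).
    { eapply Rle_lt_trans; [|exact Hz].
      replace (Im z - Im p) with (Im (z - p)%C) by (destruct z, p; cbn; ring).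
      apply Im_abs_le. }
    apply Rabs_def2 in Hre.
    assert (H1 : (1 + 2 * K) * eps < Im z) by lra.
    assert (H2 : 0 < (1 + 2 * K) * eps) by nra.
    assert (H3 : ((1 + 2 * K) * eps) ^ 2 < Im z ^ 2) by nra.
    assert (H4 : 0 < eps ^ 2) by nra. nra.
  (* At the foot of the arc the contradiction is horizontal: [z] is within [d / 2] of [lam 0]. *)
  - subst s. rewrite Hq0 in Ep. subst p.
    destruct (Key (d / 2) ltac:(lra)) as [z [Hz [Hzr _]]].
    assert (Hre : Rabs (sg * (Re z - lam 0)) < d / 2).
    { rewrite Hsga. eapply Rle_lt_trans; [|exact Hz].
      replace (Re z - lam 0) with (Re (z - RtoC (lam 0))%C) by (destruct z; cbn; ring).
      apply re_le_Cmod. }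
    apply Rabs_def2 in Hre. lra.
Qed.

(** * From the bound on the slit image to the upper limit *)

Lemma limsup_right_le (f : R -> R) (a d M : R) : 0 < d ->
  (forall t, a < t < a + d -> f t <= M) ->
  Rbar_le (limsup_right f a) (Finite M).
Proof.
  intros Hd H. unfold limsup_right.
  match goal with |- Rbar_le (Rbar_glb ?E) _ => assert (HG := proj2_sig (Rbar_ex_glb E)) end.
  destruct HG as [HG _].
  eapply Rbar_le_trans; [apply HG; exists d; split; [exact Hd|reflexivity]|].
  match goal with |- Rbar_le (Lub_Rbar ?E) _ => destruct (Lub_Rbar_correct E) as [_ HL] end.
  apply HL. intros y [t [Ht ->]]. now apply H.
Qed.

Lemma le_limsup_right (f : R -> R) (a M : R) :
  (forall t, a < t -> M <= f t) ->
  Rbar_le (Finite M) (limsup_right f a).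
Proof.
  intros H. unfold limsup_right.
  match goal with |- Rbar_le _ (Rbar_glb ?E) => destruct (proj2_sig (Rbar_ex_glb E)) as [_ HG] end.
  apply HG. intros u [d [Hd ->]].
  match goal with |- Rbar_le _ (Lub_Rbar ?E) => destruct (Lub_Rbar_correct E) as [HL _] end.
  apply Rbar_le_trans with (Finite (f (a + d / 2))); [apply H; lra|].
  apply HL. exists (a + d / 2). split; [lra|reflexivity].
Qed.

(** The quotient is bounded at every time below [T], before any limit is taken: [hp t] belongs to
    the slit image, and the Hölder bound for the pair [0], [s] gives
    [lam s - lam 0 <= c * sqrt s]. *)
Lemma singular_growth_upper (J : R -> Prop) (c : R) : time_interval J ->
  singular_growth_bound J c ((c + sqrt (c ^ 2 + 16)) / 2).
Proof.
  intros [HJ0 [[T [HT HJT]] [_ HJ]]] lam h gam hm hp [Hlip _] Hgen _ [_ [Hp0 Hsing]].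
  assert (Hs : 0 < sqrt (c ^ 2 + 16)) by (apply sqrt_lt_R0; nra).
  assert (Hs2 : sqrt (c ^ 2 + 16) * sqrt (c ^ 2 + 16) = c ^ 2 + 16) by (apply sqrt_sqrt; nra).
  set (A := (c + sqrt (c ^ 2 + 16)) / 2).
  assert (HA : 0 < A) by (unfold A; nra).
  assert (HAc : A * (A - c) = 4) by (unfold A; nra).
  apply limsup_right_le with T; [exact HT|]. intros t Ht.
  assert (HJt : J t) by (apply (HJ t T HJT); lra).
  assert (Ht0 : 0 < t) by lra.
  destruct (Hgen t HJt Ht0) as [Hj [Hsol _]].
  destruct (Hsing t HJt Ht0) as [Hmp Hx].
  assert (Hsq : 0 < sqrt t) by now apply sqrt_lt_R0.
  apply Rle_div_l; [exact Hsq|]. rewrite Hp0.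
  rewrite <- (Rmult_1_l (hp t - lam 0)).
  apply (slit_image_bound 1 A c t lam h gam); auto; [ring| |apply Hx; lra].
  intros s Hst. rewrite Rmult_1_l.
  assert (HJs : J s) by (apply (HJ s t HJt); lra).
  assert (Hl := Hlip 0 s HJ0 HJs). rewrite Rminus_0_r in Hl.
  rewrite (Rabs_pos_eq s) in Hl by lra.
  eapply Rle_trans; [apply Rle_abs|exact Hl].
Qed.

(** * The logarithm on the upper half-plane *)

(** The arc cotangent of [Re z / Im z]: on the upper half-plane a single smooth formula, with no
    case distinction on the sign of [Re z]. *)
Definition Carg (z : C) : R := PI / 2 - atan (Re z / Im z).

Definition Clog (z : C) : C := (ln (Cmod z), Carg z).

Definition Cpolar (r th : R) : C := (r * cos th, r * sin th).

Lemma Carg_bound (z : C) : 0 < Carg z < PI.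
Proof. unfold Carg. assert (H := atan_bound (Re z / Im z)). lra. Qed.

Lemma Cmod_polar (r th : R) : 0 <= r -> Cmod (Cpolar r th) = r.
Proof.
  intros Hr. unfold Cmod, Cpolar; simpl fst; simpl snd.
  replace ((r * cos th) ^ 2 + (r * sin th) ^ 2) with (r ^ 2 * (Rsqr (sin th) + Rsqr (cos th)))
    by (unfold Rsqr; ring).
  rewrite sin2_cos2, Rmult_1_r. now apply sqrt_pow2.
Qed.

Lemma Carg_polar (r th : R) : 0 < r -> 0 < th < PI -> Carg (Cpolar r th) = th.
Proof.
  intros Hr Hth. unfold Carg, Cpolar; simpl Re; simpl Im.
  assert (Hs := sin_gt_0 th (proj1 Hth) (proj2 Hth)).
  replace (r * cos th / (r * sin th)) with (tan (PI / 2 - th)).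
  - rewrite atan_tan; lra.
  - unfold tan. rewrite sin_shift, cos_shift. field. lra.
Qed.

Lemma Cpolar_upper (r th : R) : 0 < r -> 0 < th < PI -> upper_half_plane (Cpolar r th).
Proof.
  intros Hr Hth. unfold upper_half_plane; simpl.
  apply Rmult_lt_0_compat; [exact Hr|]. now apply sin_gt_0.
Qed.

Lemma Cpolar_mod_arg (z : C) : upper_half_plane z -> z = Cpolar (Cmod z) (Carg z).
Proof.
  intros Hz. unfold upper_half_plane in Hz. destruct z as [x y]. simpl in Hz.
  unfold Cpolar, Carg. simpl Re; simpl Im.
  rewrite cos_shift, sin_shift, sin_atan, cos_atan.
  assert (E : sqrt (1 + (x / y)²) = Cmod (x, y) / y).
  { unfold Cmod; simpl fst; simpl snd.
    replace (1 + (x / y)²) with ((x ^ 2 + y ^ 2) / y ^ 2) by (unfold Rsqr; field; lra).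
    rewrite sqrt_div_alt by nra. rewrite sqrt_pow2 by lra. reflexivity. }
  rewrite E.
  assert (0 < Cmod (x, y)).
  { apply Cmod_gt_0. intros E'. injection E'. lra. }
  apply injective_projections; simpl; field; lra.
Qed.

Lemma Cmod_upper (z : C) : upper_half_plane z -> 0 < Cmod z.
Proof.
  intros Hz. apply Cmod_gt_0. intros E. subst. unfold upper_half_plane in Hz. simpl in Hz. lra.
Qed.

Lemma Clog_polar (r th : R) : 0 < r -> 0 < th < PI -> Clog (Cpolar r th) = (ln r, th).
Proof. intros Hr Hth. unfold Clog. rewrite Cmod_polar, Carg_polar; auto; lra. Qed.

Lemma Clog_inj (z z' : C) : upper_half_plane z -> upper_half_plane z' ->
  Clog z = Clog z' -> z = z'.
Proof.
  intros Hz Hz' E. injection E. intros E2 E1.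
  rewrite (Cpolar_mod_arg z Hz), (Cpolar_mod_arg z' Hz'), E2. f_equal.
  apply ln_inv; auto using Cmod_upper.
Qed.

Definition line (z k : C) (s : R) : C := (Re z + s * Re k, Im z + s * Im k).

Lemma line_0 (z k : C) : line z k 0 = z.
Proof. destruct z. unfold line; simpl. f_equal; ring. Qed.

Lemma line_1 (z k : C) : line z k 1 = (z + k)%C.
Proof. destruct z, k. unfold line; simpl. unfold Cplus; simpl. f_equal; ring. Qed.

Lemma line_eq (z k : C) (s : R) : line z k s = (z + RtoC s * k)%C.
Proof. destruct z, k. unfold line; simpl. apply injective_projections; simpl; ring. Qed.

Lemma line_minus (z k : C) (s : R) : (line z k s - z = RtoC s * k)%C.
Proof. destruct z, k. unfold line; simpl. apply injective_projections; simpl; ring. Qed.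

Lemma line_upper (z k : C) (s : R) : 0 <= s <= 1 -> upper_half_plane z ->
  upper_half_plane (z + k)%C -> upper_half_plane (line z k s).
Proof.
  unfold upper_half_plane. destruct z as [x y], k as [p q]; simpl. intros Hs Hy Hq.
  replace (y + s * q) with ((1 - s) * y + s * (y + q)) by ring.
  destruct (Rle_or_lt s (1 / 2)); nra.
Qed.

Lemma sum_sq_pos (x y : R) : 0 < y -> 0 < x ^ 2 + y ^ 2.
Proof. intros H. assert (P := pow2_ge_0 x). nra. Qed.

Lemma Clog_line_derive (z k : C) (s : R) : upper_half_plane (line z k s) ->
  is_derive (fun s => Re (Clog (line z k s))) s (Re (k / line z k s)%C) /\
  is_derive (fun s => Im (Clog (line z k s))) s (Im (k / line z k s)%C).
Proof.
  intros H. destruct z as [x y], k as [p q]. unfold upper_half_plane in H. cbn in H.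
  assert (HN := sum_sq_pos (x + s * p) _ H).
  split.
  - apply (is_derive_ext (fun s => ln (sqrt ((x + s * p) ^ 2 + (y + s * q) ^ 2)))).
    { intros r. reflexivity. }
    auto_derive.
    + simpl in HN |- *. split; [exact HN|]. split; [|exact I]. now apply sqrt_lt_R0.
    + cbn. replace ((x + s * p) * ((x + s * p) * 1) + (y + s * q) * ((y + s * q) * 1)) with
        ((x + s * p) ^ 2 + (y + s * q) ^ 2) by ring.
      assert (Hs : 0 < sqrt ((x + s * p) ^ 2 + (y + s * q) ^ 2)) by now apply sqrt_lt_R0.
      assert (E := sqrt_sqrt _ (Rlt_le _ _ HN)).
      field_simplify_eq; [|split; apply Rgt_not_eq; [nra|exact Hs]].
      replace (sqrt ((x + s * p) ^ 2 + (y + s * q) ^ 2) ^ 2) with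
        ((x + s * p) ^ 2 + (y + s * q) ^ 2) by (rewrite <- E at 1; ring).
      ring.
  - apply (is_derive_ext (fun s => PI / 2 - atan ((x + s * p) / (y + s * q)))).
    { intros r. reflexivity. }
    auto_derive; [lra|]. cbn.
    field. repeat split; apply Rgt_not_eq; nra.
Qed.

(** The mean value theorem fails for complex values, so the real and imaginary parts get separate
    intermediate points. *)
Lemma Clog_line_mean_value (z k : C) :
  upper_half_plane z -> upper_half_plane (z + k)%C ->
  exists s s', 0 < s < 1 /\ 0 < s' < 1 /\
    Re (Clog (z + k)) - Re (Clog z) = Re (k / line z k s)%C /\
    Im (Clog (z + k)) - Im (Clog z) = Im (k / line z k s')%C.
Proof.
  intros Hz Hk.
  assert (HL : forall s, 0 <= s <= 1 -> upper_half_plane (line z k s)).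
  { intros. now apply line_upper. }
  destruct (mean_value (fun s => Re (Clog (line z k s))) (fun s => Re (k / line z k s)%C) 0 1)
    as [s [Hs E]].
  { lra. }
  { intros x Hx. apply derivable_continuous_pt. eexists. apply is_derive_Reals.
    apply (Clog_line_derive z k x (HL x Hx)). }
  { intros x Hx. apply Clog_line_derive, HL. lra. }
  destruct (mean_value (fun s => Im (Clog (line z k s))) (fun s => Im (k / line z k s)%C) 0 1)
    as [s' [Hs' E']].
  { lra. }
  { intros x Hx. apply derivable_continuous_pt. eexists. apply is_derive_Reals.
    apply (Clog_line_derive z k x (HL x Hx)). }
  { intros x Hx. apply Clog_line_derive, HL. lra. }
  exists s, s'. cbn beta in E, E'. rewrite line_0, line_1 in E, E'.
  rewrite E, E'. repeat split; try lra; ring.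
Qed.

Lemma Im_le_Cmod (z : C) : Im z <= Cmod z.
Proof. eapply Rle_trans; [apply Rle_abs|apply Im_abs_le]. Qed.

Lemma upper_neq0 (z : C) : upper_half_plane z -> z <> RtoC 0.
Proof. intros H. now apply Cmod_gt_0, Cmod_upper. Qed.

Lemma upper_near (z k : C) : upper_half_plane z -> Cmod k <= Im z / 2 ->
  Im z / 2 <= Im (z + k)%C.
Proof.
  intros Hz Hk. assert (H := Im_abs_le k). assert (H2 := Rle_abs (- Im k)).
  rewrite Rabs_Ropp in H2. destruct z, k; simpl in *. lra.
Qed.

Lemma Clog_differentiable (z : C) : upper_half_plane z ->
  forall eps, 0 < eps -> exists del, 0 < del /\ del <= Im z / 2 /\
    forall k : C, Cmod k < del ->
    Cmod (Clog (z + k) - Clog z - k / z)%C <= eps * Cmod k.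
Proof.
  intros Hz eps He. assert (Hy : 0 < Im z) by exact Hz.
  (* The first bound keeps the segment at height at least [Im z / 2]; the second absorbs the error
     [4 * Cmod k ^ 2 / Im z ^ 2], the sum of the two component errors below. *)
  exists (Rmin (Im z / 2) (eps * (Im z) ^ 2 / 4)).
  split; [|split].
  { apply Rmin_glb_lt; [lra|]. assert (0 < Im z ^ 2) by nra. nra. }
  { apply Rmin_l. }
  intros k Hk.
  assert (Hk1 : Cmod k < Im z / 2) by (eapply Rlt_le_trans; [exact Hk|apply Rmin_l]).
  assert (Hk2 : Cmod k < eps * (Im z) ^ 2 / 4) by (eapply Rlt_le_trans; [exact Hk|apply Rmin_r]).
  assert (Hzk : upper_half_plane (z + k)%C).
  { assert (Q := upper_near z k Hz (Rlt_le _ _ Hk1)). unfold upper_half_plane. lra. }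
  destruct (Clog_line_mean_value z k Hz Hzk) as [s [s' [Hs [Hs' [E1 E2]]]]].
  assert (Hk0 := Cmod_ge_0 k).
  assert (B : forall r, 0 < r < 1 -> Cmod (k / line z k r - k / z)%C <= 2 * Cmod k ^ 2 / Im z ^ 2).
  { intros r Hr.
    assert (Hl : upper_half_plane (line z k r)) by (apply line_upper; auto; lra).
    assert (Hl2 : Im z / 2 <= Cmod (line z k r)).
    { assert (Q : line z k r = (z + (RtoC r * k))%C) by apply line_eq.
      rewrite Q. eapply Rle_trans; [|apply Im_le_Cmod]. apply upper_near; [exact Hz|].
      rewrite Cmod_mult, Cmod_R, Rabs_pos_eq by lra. nra. }
    assert (Q : (k / line z k r - k / z = - (RtoC r * k * k) / (line z k r * z))%C).
    { rewrite <- (line_minus z k r).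
      field. split; apply upper_neq0; assumption. }
    rewrite Q, Cmod_div by (apply Cmult_neq_0; apply upper_neq0; assumption).
    rewrite Cmod_opp, !Cmod_mult, Cmod_R, Rabs_pos_eq by lra.
    assert (Hzm := Im_le_Cmod z).
    replace (2 * Cmod k ^ 2 / Im z ^ 2) with (Cmod k ^ 2 / (Im z / 2 * Im z)) by (field; lra).
    unfold Rdiv. apply Rmult_le_compat.
    - assert (0 <= Cmod k * Cmod k) by nra. nra.
    - left. apply Rinv_0_lt_compat. apply Rmult_lt_0_compat; lra.
    - assert (0 <= Cmod k * Cmod k) by nra. nra.
    - apply Rinv_le_contravar; [nra|]. apply Rmult_le_compat; lra. }
  eapply Rle_trans; [apply Cmod_le_Re_Im|].
  assert (R1 : Re (Clog (z + k) - Clog z - k / z)%C = Re (k / line z k s - k / z)%C).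
  { transitivity (Re (k / line z k s)%C - Re (k / z)%C); [rewrite <- E1|]; reflexivity. }
  assert (R2 : Im (Clog (z + k) - Clog z - k / z)%C = Im (k / line z k s' - k / z)%C).
  { transitivity (Im (k / line z k s')%C - Im (k / z)%C); [rewrite <- E2|]; reflexivity. }
  rewrite R1, R2.
  apply (Rle_trans _ (2 * Cmod k ^ 2 / Im z ^ 2 + 2 * Cmod k ^ 2 / Im z ^ 2)).
  { apply Rplus_le_compat.
    - eapply Rle_trans; [apply re_le_Cmod|now apply B].
    - eapply Rle_trans; [apply Im_abs_le|now apply B]. }
  replace (2 * Cmod k ^ 2 / Im z ^ 2 + 2 * Cmod k ^ 2 / Im z ^ 2) with
    (4 * Cmod k ^ 2 / Im z ^ 2) by (field; lra).
  apply Rle_div_l; [nra|]. nra.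
Qed.

Lemma Clog_continuous (z : C) : upper_half_plane z ->
  forall eps, 0 < eps -> exists del, 0 < del /\ del <= Im z / 2 /\
    forall k : C, Cmod k < del -> Cmod (Clog (z + k) - Clog z)%C < eps.
Proof.
  intros Hz eps He.
  destruct (Clog_differentiable z Hz 1 Rlt_0_1) as [d [Hd [Hd2 H]]].
  assert (Hm := Cmod_upper z Hz).
  assert (Hi : 0 < / Cmod z) by now apply Rinv_0_lt_compat.
  exists (Rmin d (eps / (1 + / Cmod z))). split; [|split].
  - apply Rmin_glb_lt; [exact Hd|]. apply Rdiv_lt_0_compat; lra.
  - eapply Rle_trans; [apply Rmin_l|exact Hd2].
  - intros k Hk.
    assert (H1 : Cmod k < d) by (eapply Rlt_le_trans; [exact Hk|apply Rmin_l]).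
    assert (H2 : Cmod k < eps / (1 + / Cmod z)) by (eapply Rlt_le_trans; [exact Hk|apply Rmin_r]).
    apply Rlt_div_r in H2; [|lra].
    specialize (H k H1).
    replace (Clog (z + k) - Clog z)%C with ((Clog (z + k) - Clog z - k / z) + k / z)%C by ring.
    eapply Rle_lt_trans; [apply Cmod_triangle|].
    rewrite Cmod_div by now apply upper_neq0. unfold Rdiv. lra.
Qed.

(* The derivative of [Clog] maps the half-plane, which is convex, into the lower
   half-plane; hence (Noshiro, Warschawski) convex combinations of translates
   of [Clog] are injective, and the bound is uniform. *)
Lemma Clog_chord (z k : C) (e M : R) :
  upper_half_plane z -> upper_half_plane (z + k)%C ->
  0 < e <= Im z / 2 -> e <= Cmod k -> Cmod z <= M ->
  Im ((Clog (z + k) - Clog z) * Cconj k)%C <=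
    - (Cmod k * (e * (Im z / 2) / (M + e) ^ 2)).
Proof.
  intros Hz Hzk He Hek HM.
  assert (HL : forall s, 0 <= s <= 1 -> upper_half_plane (line z k s)).
  { intros. now apply line_upper. }
  (* [G s] is the imaginary part of [Clog (line z k s)] times the conjugate of [k]. Its derivative
     is [Im (Cmod k ^ 2 / line z k s)], which is negative. *)
  pose (G := fun s => Im (Clog (line z k s)) * Re k - Re (Clog (line z k s)) * Im k).
  assert (HG : forall s, 0 <= s <= 1 ->
     is_derive G s (- (Cmod k ^ 2 * Im (line z k s) / Cmod (line z k s) ^ 2))).
  { intros s Hs. assert (Hl := HL s Hs).
    destruct (Clog_line_derive z k s Hl) as [D1 D2].
    evar_last.
    - apply (is_derive_minus (K := R_AbsRing) (V := R_NormedModule)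
         (fun s => Im (Clog (line z k s)) * Re k) (fun s => Re (Clog (line z k s)) * Im k)).
      + apply (is_derive_ext (fun s => Re k * Im (Clog (line z k s)))); [intros; apply Rmult_comm|].
        apply is_derive_scal. exact D2.
      + apply (is_derive_ext (fun s => Im k * Re (Clog (line z k s)))); [intros; apply Rmult_comm|].
        apply is_derive_scal. exact D1.
    - rewrite !Cmod2_alt. clear D1 D2. destruct (line z k s) as [X Y].
      unfold upper_half_plane in Hl; cbn in Hl. destruct k as [p q].
      assert (HN := sum_sq_pos X Y Hl).
      unfold minus, plus, opp; cbn. field. apply Rgt_not_eq. cbn in HN. lra. }
  assert (HGc : forall s, 0 <= s <= 1 -> continuity_pt G s).
  { intros s Hs. apply derivable_continuous_pt. eexists. apply is_derive_Reals. now apply HG. }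
  (* Only the initial piece of length [e] is used quantitatively, since there height and modulus are
     controlled by those of [z]; on the rest the sign of the derivative suffices. *)
  set (s1 := e / Cmod k).
  assert (Hs1 : 0 < s1 <= 1).
  { unfold s1. split; [apply Rdiv_lt_0_compat; lra|]. apply Rle_div_l; lra. }
  assert (Hs1k : s1 * Cmod k = e) by (unfold s1; field; lra).
  destruct (mean_value G _ 0 s1 (proj1 Hs1)
     ltac:(intros; apply HGc; lra) ltac:(intros; apply HG; lra)) as [s [Hs E]].
  assert (Hdec : G 1 <= G s1).
  { destruct (Rle_lt_or_eq_dec s1 1 (proj2 Hs1)) as [H|H]; [|rewrite H; lra].
    destruct (mean_value G _ s1 1 H
     ltac:(intros; apply HGc; lra) ltac:(intros; apply HG; lra)) as [r [Hr E']].
    assert (Hl : upper_half_plane (line z k r)) by (apply HL; lra).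
    assert (0 <= Cmod k ^ 2 * Im (line z k r) / Cmod (line z k r) ^ 2).
    { apply Rdiv_le_0_compat.
      - unfold upper_half_plane in Hl. nra.
      - apply Cmod_upper in Hl. nra. }
    cbn beta in E'. nra. }
  assert (EI : Im ((Clog (z + k) - Clog z) * Cconj k)%C = G 1 - G 0).
  { unfold G. rewrite line_0, line_1. destruct k as [p q]. simpl.
    destruct (Clog (z + (p, q)))%C, (Clog z). simpl. ring. }
  rewrite EI. cbn beta in E.
  assert (Hl : upper_half_plane (line z k s)) by (apply HL; lra).
  assert (Q : line z k s = (z + (RtoC s * k))%C) by apply line_eq.
  assert (Hsk : Cmod (RtoC s * k)%C <= e).
  { rewrite Cmod_mult, Cmod_R, Rabs_pos_eq by lra. nra. }
  assert (Him : Im z / 2 <= Im (line z k s)).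
  { rewrite Q. apply upper_near; [exact Hz|lra]. }
  assert (Hmd : Cmod (line z k s) <= M + e).
  { rewrite Q. eapply Rle_trans; [apply Cmod_triangle|]. lra. }
  assert (Hm0 := Cmod_upper _ Hl).
  assert (Hlow : Im z / 2 / (M + e) ^ 2 <= Im (line z k s) / Cmod (line z k s) ^ 2).
  { unfold Rdiv. apply Rmult_le_compat; [lra| |exact Him|].
    - left. apply Rinv_0_lt_compat. nra.
    - apply Rinv_le_contravar; nra. }
  assert (E3 : - (Cmod k ^ 2 * Im (line z k s) / Cmod (line z k s) ^ 2) * (s1 - 0) =
    - (Cmod k * (e * (Im (line z k s) / Cmod (line z k s) ^ 2)))).
  { rewrite <- Hs1k. unfold Rdiv. ring. }
  assert (E4 : Cmod k * (e * (Im z / 2) / (M + e) ^ 2) =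
     Cmod k * (e * (Im z / 2 / (M + e) ^ 2))) by (unfold Rdiv; ring).
  rewrite E4. rewrite E3 in E.
  assert (0 <= Cmod k * e) by (assert (Q1 := Cmod_ge_0 k); nra).
  nra.
Qed.

(** * Weighted means of logarithms *)

Definition log_mean (al A B : R) (w : C) : C :=
  (RtoC al * Clog (w - RtoC A) + RtoC (1 - al) * Clog (w - RtoC B))%C.

Lemma Re_log_mean (al A B : R) (w : C) : Re (log_mean al A B w) =
  al * ln (Cmod (w - RtoC A)) + (1 - al) * ln (Cmod (w - RtoC B)).
Proof. unfold log_mean. cbn -[Cmod Carg Cminus]. ring. Qed.

Lemma Im_log_mean (al A B : R) (w : C) : Im (log_mean al A B w) =
  al * Carg (w - RtoC A) + (1 - al) * Carg (w - RtoC B).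
Proof. unfold log_mean. cbn -[Cmod Carg Cminus]. ring. Qed.

Lemma Im_minus_R (w : C) (a : R) : Im (w - RtoC a)%C = Im w.
Proof. destruct w. cbn. ring. Qed.

Lemma upper_minus_R (w : C) (a : R) : upper_half_plane w -> upper_half_plane (w - RtoC a)%C.
Proof. unfold upper_half_plane. now rewrite Im_minus_R. Qed.

(** Translation does not change the chord [k], so the two [Clog_chord] estimates refer to the same
    direction and survive a convex combination. The constant depends on [A] and [B] only through
    [M], which gives uniformity in the parameters. *)
Lemma log_mean_chord (al A B e M : R) (w w' : C) : 0 < al < 1 ->
  upper_half_plane w -> upper_half_plane w' ->
  0 < e <= Im w / 2 -> e <= Cmod (w' - w)%C ->
  Cmod (w - RtoC A)%C <= M -> Cmod (w - RtoC B)%C <= M ->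
  e * (Im w / 2) / (M + e) ^ 2 <= Cmod (log_mean al A B w' - log_mean al A B w)%C.
Proof.
  intros Hal Hw Hw' He Hek HA HB. set (k := (w' - w)%C) in *.
  assert (HC : forall a : R, Cmod (w - RtoC a)%C <= M ->
    Im ((Clog (w' - RtoC a) - Clog (w - RtoC a)) * Cconj k)%C <=
    - (Cmod k * (e * (Im w / 2) / (M + e) ^ 2))).
  { intros a Ha. assert (E : (w' - RtoC a = (w - RtoC a) + k)%C) by (unfold k; ring).
    rewrite E. assert (P := Clog_chord (w - RtoC a) k e M). rewrite Im_minus_R in P.
    apply P; auto.
    - now apply upper_minus_R.
    - rewrite <- E. now apply upper_minus_R. }
  assert (HA' := HC A HA). assert (HB' := HC B HB).
  set (m := e * (Im w / 2) / (M + e) ^ 2) in *.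
  assert (E : Im ((log_mean al A B w' - log_mean al A B w) * Cconj k)%C =
     al * Im ((Clog (w' - RtoC A) - Clog (w - RtoC A)) * Cconj k)%C +
     (1 - al) * Im ((Clog (w' - RtoC B) - Clog (w - RtoC B)) * Cconj k)%C).
  { unfold log_mean. generalize (Clog (w' - RtoC A)) (Clog (w - RtoC A))
      (Clog (w' - RtoC B)) (Clog (w - RtoC B)) k.
    intros [] [] [] [] []. cbn. ring. }
  assert (H1 : Cmod k * m <= Rabs (Im ((log_mean al A B w' - log_mean al A B w) * Cconj k)%C)).
  { rewrite <- Rabs_Ropp. eapply Rle_trans; [|apply Rle_abs]. rewrite E. nra. }
  assert (H2 := Im_abs_le ((log_mean al A B w' - log_mean al A B w) * Cconj k)%C).
  rewrite Cmod_mult, Cmod_conj in H2.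
  apply (Rmult_le_reg_l (Cmod k)); lra.
Qed.

Lemma log_mean_inj (al A B : R) (w w' : C) : 0 < al < 1 ->
  upper_half_plane w -> upper_half_plane w' ->
  log_mean al A B w = log_mean al A B w' -> w = w'.
Proof.
  intros Hal Hw Hw' E. apply NNPP. intros Hne.
  assert (Hk : 0 < Cmod (w' - w)%C).
  { apply Cmod_gt_0. intros E'. apply Hne. rewrite <- (Cplus_0_l w), <- E'. ring. }
  assert (Hy : 0 < Im w) by exact Hw.
  set (e := Rmin (Im w / 2) (Cmod (w' - w)%C)).
  assert (He : 0 < e) by (apply Rmin_glb_lt; lra).
  set (M := Rmax (Cmod (w - RtoC A)%C) (Cmod (w - RtoC B)%C)).
  assert (HM : 0 <= M) by (eapply Rle_trans; [apply Cmod_ge_0|apply Rmax_l]).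
  assert (H := log_mean_chord al A B e M w w' Hal Hw Hw'
    (conj He (Rmin_l _ _)) (Rmin_r _ _) (Rmax_l _ _) (Rmax_r _ _)).
  rewrite E in H. replace (log_mean al A B w' - log_mean al A B w')%C with (RtoC 0) in H by ring.
  rewrite Cmod_0 in H.
  assert (0 < e * (Im w / 2) / (M + e) ^ 2) by (apply Rdiv_lt_0_compat; nra).
  lra.
Qed.

(** * The range of the weighted mean of logarithms *)

Lemma sin_lipschitz (x y : R) : Rabs (sin x - sin y) <= Rabs (x - y).
Proof.
  destruct (MVT_gen sin y x cos) as [c [_ E]].
  - intros. apply is_derive_sin.
  - intros. apply continuity_sin.
  - rewrite E, Rabs_mult.
    assert (Rabs (cos c) <= 1) by (apply Rabs_le; apply COS_bound).
    assert (P := Rabs_pos (x - y)). nra.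
Qed.

(** Strict concavity of the sine on [[0, PI]], obtained from the monotonicity of its derivative. The
    strictness later keeps images of half-plane points off the tip of the slit. *)
Lemma sin_scale_gt (a x : R) : 0 < a < 1 -> 0 < x < PI -> a * sin x < sin (a * x).
Proof.
  intros Ha Hx.
  destruct (mean_value (fun x => sin (a * x) - a * sin x)
    (fun x => a * cos (a * x) - a * cos x) 0 x) as [y [Hy E]].
  - lra.
  - intros y _. apply derivable_continuous_pt, ex_derive_Reals_0. auto_derive. exact I.
  - intros y _. auto_derive; [exact I|ring].
  - cbn beta in E. rewrite Rmult_0_r, sin_0 in E.
    assert (cos y < cos (a * y)) by (apply cos_decreasing_1; nra).
    assert (0 < (a * cos (a * y) - a * cos y) * (x - 0)).
    { apply Rmult_lt_0_compat; nra. }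
    lra.
Qed.

(* With [th1 = th + (1 - al) * phi] and [th2 = th - al * phi] the arguments at a
   point [w] of [w - A] and [w - B], where [A - B = d], this is
   [al * ln |w - A| + (1 - al) * ln |w - B|]. *)
Definition ray_profile (al th d phi : R) : R :=
  ln d + al * ln (sin (th - al * phi)) + (1 - al) * ln (sin (th + (1 - al) * phi))
  - ln (sin phi).

(** [phi] is the angle under which the segment from [B] to [A] is seen from [w]. The conditions say
    that the triangle is nondegenerate; the law of sines then gives its sides and thus
    [ray_profile]. *)
Definition ray_angle (al th phi : R) : Prop :=
  0 < phi < PI /\ 0 < th - al * phi /\ th + (1 - al) * phi < PI.

(** As [phi] tends to 0 the point [w] goes to infinity: both numerator sines stay near [sin th],
    while [sin phi] vanishes. *)
Lemma ray_profile_large (al th d y : R) : 0 < al < 1 -> 0 < th < PI -> 0 < d ->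
  exists phi, ray_angle al th phi /\ y < ray_profile al th d phi.
Proof.
  intros Hal Hth Hd.
  assert (Hs := sin_gt_0 th (proj1 Hth) (proj2 Hth)).
  assert (Hs1 := sin_lt_x th (proj1 Hth)).
  assert (Hs2 : sin th < PI - th).
  { rewrite <- sin_PI_x. apply sin_lt_x. lra. }
  (* Chosen so that [ln d + ln (sin th / 2) - ln q] equals [y + ln 2]. *)
  set (q := d * (sin th / 2) * exp (- y) / 2).
  assert (Hq : 0 < q).
  { unfold q. assert (P := exp_pos (- y)).
    apply Rdiv_lt_0_compat; [|lra]. repeat apply Rmult_lt_0_compat; lra. }
  set (phi := Rmin (sin th / 2) q).
  assert (Hphi : 0 < phi) by (apply Rmin_glb_lt; lra).
  assert (Hphi1 : phi <= sin th / 2) by apply Rmin_l.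
  assert (Hphi2 : phi <= q) by apply Rmin_r.
  exists phi. split; [repeat split; nra|].
  assert (L : forall x, Rabs (x - th) <= phi -> ln (sin th / 2) <= ln (sin x)).
  { intros x Hx. apply ln_le; [lra|]. assert (P := sin_lipschitz th x).
    rewrite Rabs_minus_sym in P.
    assert (P2 := Rle_abs (sin th - sin x)). rewrite Rabs_minus_sym in P2.
    rewrite (Rabs_minus_sym th x) in P. lra. }
  assert (L1 : ln (sin th / 2) <= ln (sin (th - al * phi))).
  { apply L. replace (th - al * phi - th) with (- (al * phi)) by ring.
    rewrite Rabs_Ropp, Rabs_pos_eq; nra. }
  assert (L2 : ln (sin th / 2) <= ln (sin (th + (1 - al) * phi))).
  { apply L. replace (th + (1 - al) * phi - th) with ((1 - al) * phi) by ring.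
    rewrite Rabs_pos_eq; nra. }
  assert (L3 : ln (sin phi) <= ln q).
  { assert (Hsp := sin_lt_x phi Hphi).
    apply ln_le; [|lra]. apply sin_gt_0; lra. }
  assert (L4 : ln q = ln d + ln (sin th / 2) - y - ln 2).
  { unfold q. rewrite ln_div, !ln_mult, ln_exp; try lra; try apply exp_pos.
    - apply Rmult_lt_0_compat; lra.
    - repeat apply Rmult_lt_0_compat; try lra. apply exp_pos. }
  assert (L5 : 0 < ln 2) by (rewrite <- ln_1; apply ln_increasing; lra).
  unfold ray_profile. nra.
Qed.

Lemma ln_sin_le0 (x : R) : 0 < sin x -> ln (sin x) <= 0.
Proof. intros H. rewrite <- ln_1. apply ln_le; [exact H|apply SIN_bound]. Qed.

(** As [phi] increases to [th / al], the argument of [w - B] tends to 0 and [w] tends to [A]; since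
    [th / al < PI], [sin phi] stays away from 0 and the term [al * ln (sin (th - al * phi))]
    diverges. *)
Lemma ray_profile_small_left (al th d y : R) : 0 < al < 1 -> 0 < th < PI * al -> 0 < d ->
  exists phi, ray_angle al th phi /\ ray_profile al th d phi < y.
Proof.
  intros Hal Hth Hd.
  set (pm := th / al).
  assert (Epm : al * pm = th) by (unfold pm; field; lra).
  assert (Hpm : 0 < pm < PI) by nra.
  assert (Hs := sin_gt_0 pm (proj1 Hpm) (proj2 Hpm)).
  set (m := sin pm / 2).
  (* Solves [ln d + al * (ln al + E) - ln m = y - 1], where [ln al + E] bounds the divergent
     logarithm. *)
  set (E := (y - 1 - ln d + ln m) / al - ln al).
  set (x := Rmin (Rmin m (pm / 2)) (exp E)).
  assert (Hm : 0 < m) by (unfold m; lra).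
  assert (Hx : 0 < x) by (repeat apply Rmin_glb_lt; try lra; apply exp_pos).
  assert (Hx1 : x <= m) by (eapply Rle_trans; [apply Rmin_l|apply Rmin_l]).
  assert (Hx2 : x <= pm / 2) by (eapply Rle_trans; [apply Rmin_l|apply Rmin_r]).
  assert (Hx3 : x <= exp E) by apply Rmin_r.
  exists (pm - x).
  assert (E1 : th - al * (pm - x) = al * x) by (rewrite <- Epm; ring).
  assert (E2 : th + (1 - al) * (pm - x) = pm - (1 - al) * x) by (rewrite <- Epm; ring).
  split; [repeat split; nra|].
  unfold ray_profile. rewrite E1, E2.
  assert (Hlx : ln x <= E) by (rewrite <- (ln_exp E); now apply ln_le).
  assert (H1 : ln (sin (al * x)) <= ln al + E).
  { apply (Rle_trans _ (ln (al * x))).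
    - assert (P := sin_lt_x (al * x) ltac:(nra)). apply ln_le; [|lra].
      apply sin_gt_0; nra.
    - rewrite ln_mult by lra. lra. }
  assert (H2 : ln (sin (pm - (1 - al) * x)) <= 0).
  { apply ln_sin_le0, sin_gt_0; nra. }
  assert (H3 : ln m <= ln (sin (pm - x))).
  { apply ln_le; [exact Hm|]. assert (P := sin_lipschitz pm (pm - x)).
    replace (pm - (pm - x)) with x in P by ring. rewrite (Rabs_pos_eq x) in P by lra.
    assert (P2 := Rle_abs (sin pm - sin (pm - x))). unfold m in *. lra. }
  assert (H4 : al * (ln al + E) = y - 1 - ln d + ln m) by (unfold E; field; lra).
  nra.
Qed.

(** On this critical ray all three sines vanish together as [phi] tends to [PI], and the profile has
    a finite limit. That limit is the logarithm of the slit length, which is why this ray alone is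
    cut. *)
Lemma ray_profile_small_mid (al d y : R) : 0 < al < 1 -> 0 < d ->
  ln d + al * ln al + (1 - al) * ln (1 - al) < y ->
  exists phi, ray_angle al (PI * al) phi /\ ray_profile al (PI * al) d phi < y.
Proof.
  intros Hal Hd Hy.
  set (K := ln d + al * ln al + (1 - al) * ln (1 - al)) in *.
  assert (Hpi := PI_RGT_0).
  assert (Hq : exp (- (y - K)) < 1) by (rewrite <- exp_0; apply exp_increasing; lra).
  assert (Hd0 : derivable_pt_lim sin 0 1) by apply derivable_pt_lim_sin_0.
  (* The slope 1 of the sine at 0 gives [sin x > exp (- (y - K)) * x] for small [x]; this factor
     leaves exactly the room between [K] and [y]. *)
  destruct (Hd0 (1 - exp (- (y - K))) ltac:(lra)) as [del Hdel].
  set (x := Rmin (del / 2) (PI / 2)).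
  assert (Hx : 0 < x) by (apply Rmin_glb_lt; [apply is_pos_div_2|lra]).
  assert (Hx1 : x <= del / 2) by apply Rmin_l.
  assert (Hx2 : x <= PI / 2) by apply Rmin_r.
  assert (Hdp := cond_pos del).
  specialize (Hdel x ltac:(lra) ltac:(rewrite Rabs_pos_eq; lra)).
  rewrite Rplus_0_l, sin_0, Rminus_0_r in Hdel. apply Rabs_def2 in Hdel.
  assert (Hsx : exp (- (y - K)) * x < sin x).
  { apply Rlt_div_r; [exact Hx|]. lra. }
  assert (Hln : K - y + ln x < ln (sin x)).
  { replace (K - y + ln x) with (ln (exp (- (y - K)) * x)).
    - apply ln_increasing; [|exact Hsx]. apply Rmult_lt_0_compat; [apply exp_pos|exact Hx].
    - rewrite ln_mult, ln_exp by (exact Hx || apply exp_pos). ring. }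
  exists (PI - x). split; [repeat split; nra|].
  unfold ray_profile.
  replace (PI * al - al * (PI - x)) with (al * x) by ring.
  replace (PI * al + (1 - al) * (PI - x)) with (PI - (1 - al) * x) by ring.
  rewrite !sin_PI_x.
  assert (H : forall a, 0 < a < 1 -> ln (sin (a * x)) <= ln a + ln x).
  { intros a Ha. rewrite <- ln_mult by lra.
    assert (P := sin_lt_x (a * x) ltac:(nra)). apply ln_le; [|lra]. apply sin_gt_0; nra. }
  assert (H1 := H al Hal). assert (H2 := H (1 - al) ltac:(lra)).
  unfold K in *. nra.
Qed.

(** Intermediate values between a small and a large value of the profile, the admissible angles
    forming an interval. The case [th > PI * al] reduces to the opposite one by reflection, which
    exchanges [al] with [1 - al] and [th] with [PI - th]. *)
Lemma ray_profile_surj (al th d y : R) : 0 < al < 1 -> 0 < th < PI -> 0 < d ->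
  (th = PI * al -> ln d + al * ln al + (1 - al) * ln (1 - al) < y) ->
  exists phi, ray_angle al th phi /\ ray_profile al th d phi = y.
Proof.
  intros Hal Hth Hd Hy.
  assert (Hsmall : exists phi, ray_angle al th phi /\ ray_profile al th d phi < y).
  { destruct (Rtotal_order th (PI * al)) as [H|[H|H]].
    - apply ray_profile_small_left; lra.
    - rewrite H. apply ray_profile_small_mid; auto.
    - destruct (ray_profile_small_left (1 - al) (PI - th) d y) as [phi [[H1 [H2 H3]] H4]];
        try lra.
      exists phi. split; [repeat split; lra|].
      unfold ray_profile in *.
      replace (PI - th - (1 - al) * phi) with (PI - (th + (1 - al) * phi)) in H4 by ring.
      replace (PI - th + (1 - (1 - al)) * phi) with (PI - (th - al * phi)) in H4 by ring.
      rewrite !sin_PI_x in H4. lra. }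
  destruct Hsmall as [p [Hp Hpy]].
  destruct (ray_profile_large al th d y Hal Hth Hd) as [q [Hq Hqy]].
  assert (Hcont : forall x, ray_angle al th x ->
     continuity_pt (fun x => ray_profile al th d x) x).
  { intros x [H1 [H2 H3]]. apply derivable_continuous_pt, ex_derive_Reals_0.
    unfold ray_profile. auto_derive. repeat split; apply sin_gt_0; nra. }
  destruct (Rtotal_order p q) as [H|[H|H]].
  - destruct (Ranalysis5.IVT_interv (fun x => ray_profile al th d x - y) p q) as [x [Hx E]];
      try lra.
    + intros x Hx. apply continuity_pt_minus; [|apply continuity_const; intros ? ?; reflexivity].
      apply Hcont. destruct Hp as [? [? ?]], Hq as [? [? ?]]. repeat split; nra.
    + exists x. split; [|lra]. destruct Hp as [? [? ?]], Hq as [? [? ?]]. repeat split; nra.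
  - subst. lra.
  - destruct (Ranalysis5.IVT_interv (fun x => y - ray_profile al th d x) q p) as [x [Hx E]];
      try lra.
    + intros x Hx. apply continuity_pt_minus; [apply continuity_const; intros ? ?; reflexivity|].
      apply Hcont. destruct Hp as [? [? ?]], Hq as [? [? ?]]. repeat split; nra.
    + exists x. split; [|lra]. destruct Hp as [? [? ?]], Hq as [? [? ?]]. repeat split; nra.
Qed.

Lemma log_mean_surj (al A B : R) (z : C) : 0 < al < 1 -> B < A -> upper_half_plane z ->
  (Carg z = PI * al ->
     ln (A - B) + al * ln al + (1 - al) * ln (1 - al) < ln (Cmod z)) ->
  exists w, upper_half_plane w /\ log_mean al A B w = Clog z.
Proof.
  intros Hal HAB Hz Harg.
  destruct (ray_profile_surj al (Carg z) (A - B) (ln (Cmod z))) as [phi [[H1 [H2 H3]] E]];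
    auto using Carg_bound; [lra|].
  set (t1 := Carg z + (1 - al) * phi) in *. set (t2 := Carg z - al * phi) in *.
  assert (Hphi : phi = t1 - t2) by (unfold t1, t2; ring).
  assert (Ht : 0 < t2 < t1) by lra.
  assert (Hs1 : 0 < sin t1) by (apply sin_gt_0; lra).
  assert (Hs2 : 0 < sin t2) by (apply sin_gt_0; lra).
  assert (Hsp : 0 < sin phi) by (apply sin_gt_0; lra).
  (* Law of sines: the distances from the sought point to [A] and to [B]. *)
  set (ra := (A - B) * sin t2 / sin phi). set (rb := (A - B) * sin t1 / sin phi).
  assert (Hra : 0 < ra) by (apply Rdiv_lt_0_compat; [apply Rmult_lt_0_compat; lra|exact Hsp]).
  assert (Hrb : 0 < rb) by (apply Rdiv_lt_0_compat; [apply Rmult_lt_0_compat; lra|exact Hsp]).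
  exists (RtoC A + Cpolar ra t1)%C.
  assert (EA : (RtoC A + Cpolar ra t1 - RtoC A = Cpolar ra t1)%C) by ring.
  assert (EB : (RtoC A + Cpolar ra t1 - RtoC B = Cpolar rb t2)%C).
  { assert (Es : sin phi = sin t1 * cos t2 - cos t1 * sin t2) by (rewrite Hphi; apply sin_minus).
    unfold Cpolar, ra, rb. apply injective_projections; cbn.
    - field_simplify_eq; [rewrite Es; ring|lra].
    - field. lra. }
  split.
  - unfold upper_half_plane. replace (Im (RtoC A + Cpolar ra t1)%C) with (ra * sin t1)
      by (cbn; ring). now apply Rmult_lt_0_compat.
  - unfold log_mean. rewrite EA, EB, !Clog_polar by lra.
    unfold Clog. apply injective_projections; cbn -[Cmod Carg].
    + rewrite <- E. unfold ray_profile. fold t1 t2. unfold ra, rb.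
      rewrite !ln_div, !ln_mult by (try lra; apply Rmult_lt_0_compat; lra). ring.
    + unfold t1, t2. ring.
Qed.

Lemma Carg_lt (z z' : C) : upper_half_plane z -> Im z' = Im z -> Re z < Re z' ->
  Carg z' < Carg z.
Proof.
  intros Hz Ei Hr. unfold Carg. rewrite Ei. unfold upper_half_plane in Hz.
  assert (atan (Re z / Im z) < atan (Re z' / Im z)); [|lra].
  apply atan_increasing. apply Rmult_lt_compat_r; [now apply Rinv_0_lt_compat|exact Hr].
Qed.

(** On the critical ray the triangle has angles [al * X] at [B] and [(1 - al) * X] at [A]. The law
    of sines and [sin_scale_gt] give [Cmod (w - A) > (A - B) * al] and
    [Cmod (w - B) > (A - B) * (1 - al)]. *)
Lemma log_mean_avoids_slit (al A B : R) (w : C) : 0 < al < 1 -> B < A ->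
  upper_half_plane w -> Im (log_mean al A B w) = PI * al ->
  ln (A - B) + al * ln al + (1 - al) * ln (1 - al) < Re (log_mean al A B w).
Proof.
  intros Hal HAB Hw Him. rewrite Im_log_mean in Him. rewrite Re_log_mean.
  assert (HwA := upper_minus_R w A Hw). assert (HwB := upper_minus_R w B Hw).
  assert (Ht : Carg (w - RtoC B) < Carg (w - RtoC A)).
  { apply Carg_lt; [exact HwA|now rewrite !Im_minus_R|]. destruct w; cbn. lra. }
  assert (PA := Cpolar_mod_arg _ HwA). assert (PB := Cpolar_mod_arg _ HwB).
  assert (MA := Cmod_upper _ HwA). assert (MB := Cmod_upper _ HwB).
  assert (BA := Carg_bound (w - RtoC A)%C). assert (BB := Carg_bound (w - RtoC B)%C).
  set (t1 := Carg (w - RtoC A)) in *. set (t2 := Carg (w - RtoC B)) in *.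
  set (ra := Cmod (w - RtoC A)) in *. set (rb := Cmod (w - RtoC B)) in *.
  assert (EA1 := f_equal Re PA). assert (EA2 := f_equal Im PA).
  assert (EB1 := f_equal Re PB). assert (EB2 := f_equal Im PB).
  rewrite Im_minus_R in EA2, EB2. simpl Im in EA2, EB2.
  assert (Er : Re (w - RtoC A)%C + A = Re (w - RtoC B)%C + B) by (destruct w; cbn; ring).
  rewrite EA1, EB1 in Er. simpl Re in Er.
  set (X := PI - (t1 - t2)).
  assert (Et2 : t2 = al * X) by (unfold X; lra).
  assert (Et1 : t1 = PI - (1 - al) * X) by (unfold X; lra).
  assert (HX : 0 < X < PI) by (unfold X; lra).
  assert (HsX := sin_gt_0 X (proj1 HX) (proj2 HX)).
  assert (EsX : sin X = sin t1 * cos t2 - cos t1 * sin t2).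
  { unfold X. rewrite sin_PI_x. apply sin_minus. }
  assert (Ed : A - B = rb * cos t2 - ra * cos t1) by lra.
  assert (Es12 : ra * sin t1 = rb * sin t2) by lra.
  assert (E1 : ra * sin X = (A - B) * sin t2).
  { rewrite EsX, Ed. transitivity (ra * sin t1 * cos t2 - ra * cos t1 * sin t2); [ring|].
    rewrite Es12. ring. }
  assert (E2 : rb * sin X = (A - B) * sin t1).
  { rewrite EsX, Ed. transitivity (rb * sin t1 * cos t2 - rb * sin t2 * cos t1); [ring|].
    rewrite <- Es12. ring. }
  assert (G2 : (A - B) * al < ra).
  { apply (Rmult_lt_reg_r (sin X)); [exact HsX|]. rewrite E1, Et2.
    assert (P := sin_scale_gt al X Hal HX). nra. }
  assert (G1 : (A - B) * (1 - al) < rb).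
  { apply (Rmult_lt_reg_r (sin X)); [exact HsX|]. rewrite E2, Et1, sin_PI_x.
    assert (P := sin_scale_gt (1 - al) X ltac:(lra) HX). nra. }
  apply ln_increasing in G1; [|apply Rmult_lt_0_compat; lra].
  apply ln_increasing in G2; [|apply Rmult_lt_0_compat; lra].
  rewrite ln_mult in G1 by lra. rewrite ln_mult in G2 by lra.
  nra.
Qed.

(** * Joint dependence on the point and on the parameters *)

Lemma log_mean_differentiable (al A B : R) (w : C) : 0 < al < 1 -> upper_half_plane w ->
  forall eps, 0 < eps -> exists del, 0 < del /\
  forall (A' B' : R) (k : C), Cmod k < del -> Rabs (A' - A) < del -> Rabs (B' - B) < del ->
  Cmod (log_mean al A' B' (w + k) - log_mean al A B w
    - (RtoC al * ((k - RtoC (A' - A)) / (w - RtoC A))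
       + RtoC (1 - al) * ((k - RtoC (B' - B)) / (w - RtoC B))))%C
  <= eps * (Cmod k + Rabs (A' - A) + Rabs (B' - B)).
Proof.
  intros Hal Hw eps He.
  destruct (Clog_differentiable _ (upper_minus_R w A Hw) eps He) as [d1 [Hd1 [_ H1]]].
  destruct (Clog_differentiable _ (upper_minus_R w B Hw) eps He) as [d2 [Hd2 [_ H2]]].
  exists (Rmin d1 d2 / 2).
  assert (Hm := Rmin_glb_lt _ _ _ Hd1 Hd2).
  split; [lra|]. intros A' B' k Hk HA HB.
  assert (M1 := Rmin_l d1 d2). assert (M2 := Rmin_r d1 d2).
  assert (T : forall x : R, Cmod (k - RtoC x)%C <= Cmod k + Rabs x).
  { intros x. unfold Cminus. eapply Rle_trans; [apply Cmod_triangle|].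
    rewrite Cmod_opp, Cmod_R. lra. }
  assert (TA := T (A' - A)). assert (TB := T (B' - B)).
  specialize (H1 (k - RtoC (A' - A))%C ltac:(lra)).
  specialize (H2 (k - RtoC (B' - B))%C ltac:(lra)).
  assert (EA : (w - RtoC A + (k - RtoC (A' - A)) = w + k - RtoC A')%C)
    by (rewrite RtoC_minus; ring).
  assert (EB : (w - RtoC B + (k - RtoC (B' - B)) = w + k - RtoC B')%C)
    by (rewrite RtoC_minus; ring).
  rewrite EA in H1. rewrite EB in H2. unfold log_mean.
  set (X := (Clog (w + k - RtoC A') - Clog (w - RtoC A) - (k - RtoC (A' - A)) / (w - RtoC A))%C) in *.
  set (Y := (Clog (w + k - RtoC B') - Clog (w - RtoC B) - (k - RtoC (B' - B)) / (w - RtoC B))%C) in *.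
  match goal with |- Cmod ?Z <= _ => replace Z with (RtoC al * X + RtoC (1 - al) * Y)%C
    by (unfold X, Y; ring) end.
  eapply Rle_trans; [apply Cmod_triangle|].
  rewrite !Cmod_mult, !Cmod_R, !Rabs_pos_eq by lra.
  assert (PA := Rabs_pos (A' - A)). assert (PB := Rabs_pos (B' - B)).
  set (S := Cmod k + Rabs (A' - A) + Rabs (B' - B)).
  assert (G1 : Cmod X <= eps * S) by (unfold S; nra).
  assert (G2 : Cmod Y <= eps * S) by (unfold S; nra).
  nra.
Qed.

Lemma log_mean_param_continuous (al A B : R) (w : C) : 0 < al < 1 -> upper_half_plane w ->
  forall eps, 0 < eps -> exists del, 0 < del /\
  forall A' B' : R, Rabs (A' - A) < del -> Rabs (B' - B) < del ->
  Cmod (log_mean al A' B' w - log_mean al A B w)%C < eps.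
Proof.
  intros Hal Hw eps He.
  destruct (Clog_continuous _ (upper_minus_R w A Hw) eps He) as [d1 [Hd1 [_ H1]]].
  destruct (Clog_continuous _ (upper_minus_R w B Hw) eps He) as [d2 [Hd2 [_ H2]]].
  exists (Rmin d1 d2). split; [now apply Rmin_glb_lt|]. intros A' B' HA HB.
  assert (M1 := Rmin_l d1 d2). assert (M2 := Rmin_r d1 d2).
  specialize (H1 (RtoC (A - A')) ltac:(rewrite Cmod_R, Rabs_minus_sym; lra)).
  specialize (H2 (RtoC (B - B')) ltac:(rewrite Cmod_R, Rabs_minus_sym; lra)).
  replace (w - RtoC A + RtoC (A - A'))%C with (w - RtoC A')%C in H1 by (rewrite RtoC_minus; ring).
  replace (w - RtoC B + RtoC (B - B'))%C with (w - RtoC B')%C in H2 by (rewrite RtoC_minus; ring).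
  unfold log_mean.
  match goal with |- Cmod ?Z < _ => replace Z with
    (RtoC al * (Clog (w - RtoC A') - Clog (w - RtoC A)) +
     RtoC (1 - al) * (Clog (w - RtoC B') - Clog (w - RtoC B)))%C by ring end.
  eapply Rle_lt_trans; [apply Cmod_triangle|].
  rewrite !Cmod_mult, !Cmod_R, !Rabs_pos_eq by lra. nra.
Qed.

(** Takes the place of an inverse function theorem: if [w'] were at distance at least [e] from [w],
    the chord bound for the moved parameters would separate the two values by [m], more than the two
    errors below [m / 2] allow. The [+ 1] in [M] absorbs the motion of the parameters. *)
Lemma log_mean_inverse_continuous (al A B : R) (w : C) : 0 < al < 1 -> upper_half_plane w ->
  forall eps, 0 < eps -> exists del, 0 < del /\
  forall (A' B' : R) (w' : C), Rabs (A' - A) < del -> Rabs (B' - B) < del ->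
  upper_half_plane w' -> Cmod (log_mean al A' B' w' - log_mean al A B w)%C < del ->
  Cmod (w' - w)%C < eps.
Proof.
  intros Hal Hw eps He. assert (Hy : 0 < Im w) by exact Hw.
  set (e := Rmin (Im w / 2) eps).
  assert (He0 : 0 < e) by (apply Rmin_glb_lt; lra).
  assert (He1 : e <= Im w / 2) by apply Rmin_l.
  assert (He2 : e <= eps) by apply Rmin_r.
  set (M := Cmod (w - RtoC A)%C + Cmod (w - RtoC B)%C + 1).
  assert (HMA := Cmod_ge_0 (w - RtoC A)%C). assert (HMB := Cmod_ge_0 (w - RtoC B)%C).
  set (m := e * (Im w / 2) / (M + e) ^ 2).
  assert (Hm : 0 < m) by (apply Rdiv_lt_0_compat; unfold M; nra).
  destruct (log_mean_param_continuous al A B w Hal Hw (m / 2) ltac:(lra)) as [d [Hd H]].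
  exists (Rmin (Rmin d 1) (m / 2)).
  split; [repeat apply Rmin_glb_lt; lra|]. intros A' B' w' HA HB Hw' HL.
  assert (Q1 := Rmin_l (Rmin d 1) (m / 2)). assert (Q2 := Rmin_r (Rmin d 1) (m / 2)).
  assert (Q3 := Rmin_l d 1). assert (Q4 := Rmin_r d 1).
  destruct (Rlt_or_le (Cmod (w' - w)%C) e) as [Hlt|Hge]; [lra|exfalso].
  assert (T : forall a a' : R, Rabs (a' - a) < 1 -> Cmod (w - RtoC a')%C <= Cmod (w - RtoC a)%C + 1).
  { intros a a' Ha. replace (w - RtoC a')%C with ((w - RtoC a) + RtoC (a - a'))%C
      by (rewrite RtoC_minus; ring).
    eapply Rle_trans; [apply Cmod_triangle|]. rewrite Cmod_R, (Rabs_minus_sym a a'). lra. }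
  assert (TA := T A A' ltac:(lra)). assert (TB := T B B' ltac:(lra)).
  assert (HC := log_mean_chord al A' B' e M w w' Hal Hw Hw' (conj He0 He1) Hge
    ltac:(unfold M; lra) ltac:(unfold M; lra)).
  fold m in HC.
  specialize (H A' B' ltac:(lra) ltac:(lra)).
  replace (log_mean al A' B' w' - log_mean al A' B' w)%C with
    ((log_mean al A' B' w' - log_mean al A B w) +
     - (log_mean al A' B' w - log_mean al A B w))%C in HC by ring.
  assert (HT := Cmod_triangle (log_mean al A' B' w' - log_mean al A B w)%C
     (- (log_mean al A' B' w - log_mean al A B w))%C).
  rewrite Cmod_opp in HT. lra.
Qed.

Lemma Im_Cinv_upper (z : C) : upper_half_plane z -> Im (/ z)%C < 0.
Proof.
  unfold upper_half_plane. destruct z as [x y]. cbn. intros H.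
  assert (HN := sum_sq_pos x y H).
  unfold Rdiv. rewrite Ropp_mult_distr_l_reverse.
  apply Ropp_lt_gt_0_contravar. apply Rmult_lt_0_compat; [exact H|].
  apply Rinv_0_lt_compat. cbn in HN. lra.
Qed.

Definition log_mean_slope (al A B : R) (w : C) : C :=
  (RtoC al / (w - RtoC A) + RtoC (1 - al) / (w - RtoC B))%C.

(** Both terms of the derivative of [log_mean] have negative imaginary part. *)
Lemma log_mean_slope_neq0 (al A B : R) (w : C) : 0 < al < 1 -> upper_half_plane w ->
  log_mean_slope al A B w <> RtoC 0.
Proof.
  intros Hal Hw E. assert (E' := f_equal Im E).
  assert (H1 := Im_Cinv_upper _ (upper_minus_R w A Hw)).
  assert (H2 := Im_Cinv_upper _ (upper_minus_R w B Hw)).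
  unfold log_mean_slope, Cdiv in E'.
  assert (E3 : forall (x : R) (z : C), Im (RtoC x * z)%C = x * Im z)
    by (intros x [a b]; cbn; ring).
  assert (E4 : forall z z' : C, Im (z + z')%C = Im z + Im z') by reflexivity.
  rewrite E4, !E3 in E'. cbn -[Cinv Cminus] in E'. nra.
Qed.

(** The last step of implicit differentiation, where the error still involves the unknown increment
    [D]. The bound [Cmod l / 2] lets [D] be absorbed, giving [Cmod D <= K * Cmod k]; the other bound
    then brings the error below [eps]. *)
Lemma implicit_slope (l m : C) (eps : R) : l <> RtoC 0 -> 0 < eps ->
  exists eps', 0 < eps' /\ forall D k : C,
    Cmod (l * D - m * k)%C <= eps' * (Cmod D + Cmod k) ->
    Cmod (D - m / l * k)%C <= eps * Cmod k.
Proof.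
  intros Hl He. assert (Hl0 : 0 < Cmod l) by now apply Cmod_gt_0.
  set (K := 2 * Cmod m / Cmod l + 1).
  assert (Hm0 := Cmod_ge_0 m).
  assert (HK : 0 < K).
  { unfold K. assert (0 <= 2 * Cmod m / Cmod l) by (apply Rdiv_le_0_compat; lra). lra. }
  exists (Rmin (Cmod l / 2) (eps * Cmod l / (1 + K))).
  split.
  { apply Rmin_glb_lt; [lra|]. apply Rdiv_lt_0_compat; [nra|lra]. }
  intros D k H.
  assert (Q1 := Rmin_l (Cmod l / 2) (eps * Cmod l / (1 + K))).
  assert (Q2 := Rmin_r (Cmod l / 2) (eps * Cmod l / (1 + K))).
  set (e := Rmin (Cmod l / 2) (eps * Cmod l / (1 + K))) in *.
  assert (HD := Cmod_ge_0 D). assert (Hk := Cmod_ge_0 k).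
  assert (HDK : Cmod D <= K * Cmod k).
  { assert (H1 : Cmod l * Cmod D <= Cmod (l * D - m * k)%C + Cmod m * Cmod k).
    { rewrite <- !Cmod_mult. replace (l * D)%C with ((l * D - m * k) + m * k)%C at 1 by ring.
      apply Cmod_triangle. }
    assert (H2 : Cmod l * Cmod D <= Cmod l / 2 * (Cmod D + Cmod k) + Cmod m * Cmod k) by nra.
    apply (Rmult_le_reg_l (Cmod l / 2)); [lra|].
    replace (Cmod l / 2 * (K * Cmod k)) with (Cmod m * Cmod k + Cmod l / 2 * Cmod k)
      by (unfold K; field; lra).
    lra. }
  replace (D - m / l * k)%C with ((l * D - m * k) / l)%C by (field; exact Hl).
  rewrite Cmod_div by exact Hl. apply Rle_div_l; [exact Hl0|].
  apply Rle_div_r in Q2; [|lra].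
  eapply Rle_trans; [exact H|].
  assert (He0 : 0 <= e).
  { unfold e. apply Rmin_glb; [lra|]. apply Rdiv_le_0_compat; [nra|lra]. }
  apply (Rle_trans _ (e * (1 + K) * Cmod k)); [nra|]. nra.
Qed.

(** * The flow driven by a multiple of the square root *)

(** The maximum of [a ^ al * b ^ (1 - al)] over positive [a], [b] with sum [(A - B) * sqrt t], that
    is, the largest modulus reached on the real interval between the two singularities. *)
Definition slit_radius (al A B t : R) : R :=
  (A - B) * sqrt t * exp (al * ln al + (1 - al) * ln (1 - al)).

Definition sqrt_slit (al A B t : R) (z : C) : Prop :=
  exists s : R, 0 <= s <= 1 /\ z = Cpolar (s * slit_radius al A B t) (PI * al).

(** The solution is unique by [log_mean_inj] and exists for [z] in the slit domain, so the choice is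
    determined there. *)
Definition sqrt_flow (al A B : R) (z : C) (t : R) : C :=
  epsilon (inhabits (RtoC 0)) (fun w : C => upper_half_plane w /\
    log_mean al (A * sqrt t) (B * sqrt t) w = Clog z).

Lemma slit_radius_ge0 (al A B t : R) : B < A -> 0 <= slit_radius al A B t.
Proof.
  intros H. assert (P := sqrt_pos t). apply Rmult_le_pos; [nra|]. left. apply exp_pos.
Qed.

Lemma slit_radius_pos (al A B t : R) : B < A -> 0 < t -> 0 < slit_radius al A B t.
Proof.
  intros H Ht. assert (P := sqrt_lt_R0 t Ht).
  apply Rmult_lt_0_compat; [nra|]. apply exp_pos.
Qed.

Lemma ln_slit_radius (al A B t : R) : B < A -> 0 < t -> ln (slit_radius al A B t) =
  ln (A * sqrt t - B * sqrt t) + al * ln al + (1 - al) * ln (1 - al).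
Proof.
  intros H Ht. assert (P := sqrt_lt_R0 t Ht). unfold slit_radius.
  rewrite ln_mult, ln_exp by (nra || apply exp_pos).
  replace (A * sqrt t - B * sqrt t) with ((A - B) * sqrt t) by ring. ring.
Qed.

Lemma PI_mult_bound (al : R) : 0 < al < 1 -> 0 < PI * al < PI.
Proof. intros H. assert (P := PI_RGT_0). nra. Qed.

Lemma sqrt_slit_domain_iff (al A B t : R) (z : C) : 0 < al < 1 -> B < A ->
  slit_domain (sqrt_slit al A B t) z <->
  upper_half_plane z /\ (Carg z = PI * al -> slit_radius al A B t < Cmod z).
Proof.
  intros Hal HAB. assert (Hpi := PI_mult_bound al Hal).
  assert (Hr := slit_radius_ge0 al A B t HAB).
  split; intros [Hz H]; (split; [exact Hz|]).
  - intros Harg. apply Rnot_le_lt. intros Hle. apply H.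
    assert (Hm := Cmod_upper z Hz).
    exists (Cmod z / slit_radius al A B t). split; [split|].
    + apply Rdiv_le_0_compat; lra.
    + apply Rle_div_l; lra.
    + rewrite (Cpolar_mod_arg z Hz) at 1. rewrite Harg. f_equal. field. lra.
  - intros [s [Hs E]].
    assert (Hsr : 0 <= s * slit_radius al A B t) by nra.
    assert (Hpos : 0 < s * slit_radius al A B t).
    { destruct Hsr as [|E0]; [easy|]. exfalso. rewrite <- E0 in E.
      subst z. unfold upper_half_plane in Hz. simpl in Hz. lra. }
    assert (Harg : Carg z = PI * al) by (rewrite E; now apply Carg_polar).
    specialize (H Harg). rewrite E, Cmod_polar in H by lra. nra.
Qed.

(** The slits grow, so a point outside the slit at time [t] has a whole trajectory on [[0, t]]. *)
Lemma sqrt_slit_domain_mono (al A B s t : R) (z : C) : 0 < al < 1 -> B < A -> 0 <= s <= t ->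
  slit_domain (sqrt_slit al A B t) z -> slit_domain (sqrt_slit al A B s) z.
Proof.
  intros Hal HAB Hst. rewrite !sqrt_slit_domain_iff by assumption.
  intros [Hz H]. split; [exact Hz|]. intros Harg.
  eapply Rle_lt_trans; [|exact (H Harg)].
  assert (P := sqrt_le_1_alt s t (proj2 Hst)). unfold slit_radius.
  apply Rmult_le_compat_r; [left; apply exp_pos|]. nra.
Qed.

Lemma sqrt_flow_eq (al A B t : R) (z w : C) : 0 < al < 1 -> upper_half_plane w ->
  log_mean al (A * sqrt t) (B * sqrt t) w = Clog z -> sqrt_flow al A B z t = w.
Proof.
  intros Hal Hw E.
  destruct (epsilon_spec (inhabits (RtoC 0)) (fun w : C => upper_half_plane w /\
    log_mean al (A * sqrt t) (B * sqrt t) w = Clog z)) as [H1 H2].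
  { now exists w. }
  apply (log_mean_inj al (A * sqrt t) (B * sqrt t)); auto. now rewrite E.
Qed.

Lemma log_mean_0 (al : R) (w : C) : log_mean al 0 0 w = Clog w.
Proof.
  unfold log_mean. replace (w - RtoC 0)%C with w by ring. rewrite RtoC_minus. ring.
Qed.

Lemma sqrt_flow_spec (al A B t : R) (z : C) : 0 < al < 1 -> B < A -> 0 <= t ->
  slit_domain (sqrt_slit al A B t) z -> upper_half_plane (sqrt_flow al A B z t) /\
  log_mean al (A * sqrt t) (B * sqrt t) (sqrt_flow al A B z t) = Clog z.
Proof.
  intros Hal HAB Ht Hz. apply sqrt_slit_domain_iff in Hz; auto. destruct Hz as [Hz Harg].
  apply (epsilon_spec (inhabits (RtoC 0)) (fun w : C => upper_half_plane w /\
    log_mean al (A * sqrt t) (B * sqrt t) w = Clog z)).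
  destruct (Rle_lt_or_eq_dec 0 t Ht) as [H|<-].
  - assert (P := sqrt_lt_R0 t H).
    apply log_mean_surj; [exact Hal|nra|exact Hz|]. intros E.
    rewrite <- ln_slit_radius by assumption.
    apply ln_increasing; [now apply slit_radius_pos|auto].
  - exists z. rewrite sqrt_0, !Rmult_0_r, log_mean_0. tauto.
Qed.

Lemma sqrt_flow_0 (al A B : R) (z : C) : 0 < al < 1 -> upper_half_plane z ->
  sqrt_flow al A B z 0 = z.
Proof.
  intros Hal Hz. apply sqrt_flow_eq; auto. rewrite sqrt_0, !Rmult_0_r. apply log_mean_0.
Qed.

Lemma sqrt_slit_domain_open (al A B t : R) (z : C) : 0 < al < 1 -> B < A ->
  slit_domain (sqrt_slit al A B t) z -> exists del, 0 < del /\
  forall k : C, Cmod k < del -> slit_domain (sqrt_slit al A B t) (z + k)%C.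
Proof.
  intros Hal HAB Hz. apply sqrt_slit_domain_iff in Hz; auto. destruct Hz as [Hz Harg].
  assert (Hy : 0 < Im z) by exact Hz.
  destruct (Req_dec (Carg z) (PI * al)) as [E|E].
  - specialize (Harg E). exists (Rmin (Im z / 2) (Cmod z - slit_radius al A B t)).
    split; [apply Rmin_glb_lt; lra|]. intros k Hk.
    assert (Q1 := Rmin_l (Im z / 2) (Cmod z - slit_radius al A B t)).
    assert (Q2 := Rmin_r (Im z / 2) (Cmod z - slit_radius al A B t)).
    apply sqrt_slit_domain_iff; auto. split.
    + assert (P := upper_near z k Hz ltac:(lra)). unfold upper_half_plane. lra.
    + intros _. assert (P := Cmod_triangle (z + k)%C (- k)%C).
      replace (z + k + - k)%C with z in P by ring. rewrite Cmod_opp in P. lra.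
  - assert (He : 0 < Rabs (Carg z - PI * al)) by (apply Rabs_pos_lt; lra).
    destruct (Clog_continuous z Hz _ He) as [d [Hd [Hd2 H]]].
    exists d. split; [exact Hd|]. intros k Hk. specialize (H k Hk).
    apply sqrt_slit_domain_iff; auto. split.
    + assert (P := upper_near z k Hz ltac:(lra)). unfold upper_half_plane. lra.
    + intros E'. exfalso.
      assert (P := Im_abs_le (Clog (z + k) - Clog z)%C).
      replace (Im (Clog (z + k) - Clog z)%C) with (Carg (z + k) - Carg z) in P
        by reflexivity.
      rewrite E', Rabs_minus_sym in P. lra.
Qed.

Lemma sqrt_flow_holomorphic (al A B t : R) (z : C) : 0 < al < 1 -> B < A -> 0 <= t ->
  slit_domain (sqrt_slit al A B t) z ->
  ex_derive (K := C_AbsRing) (V := C_NormedModule) (fun z => sqrt_flow al A B z t) z.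
Proof.
  intros Hal HAB Ht HD.
  destruct (sqrt_flow_spec al A B t z Hal HAB Ht HD) as [Hw Ew].
  set (w := sqrt_flow al A B z t) in *.
  assert (Hz : upper_half_plane z) by apply HD.
  set (A1 := A * sqrt t) in *. set (B1 := B * sqrt t) in *.
  set (l := log_mean_slope al A1 B1 w).
  (* Differentiating [log_mean w = Clog z] implicitly: [l * dw = dz / z]. *)
  exists ((/ z) / l)%C. split; [apply is_linear_scal_l|].
  intros x Hx. 
  apply (@is_filter_lim_locally_unique C_AbsRing (AbsRing_NormedModule C_AbsRing)) in Hx.
  subst x.
  intros [eps He]. simpl pos.
  destruct (implicit_slope l (/ z)%C eps) as [e [He' HI]].
  { now apply log_mean_slope_neq0. }
  { exact He. }
  destruct (log_mean_differentiable al A1 B1 w Hal Hw e He') as [d1 [Hd1 H1]].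
  destruct (Clog_differentiable z Hz e He') as [d2 [Hd2 [_ H2]]].
  destruct (log_mean_inverse_continuous al A1 B1 w Hal Hw d1 Hd1) as [d3 [Hd3 H3]].
  destruct (Clog_continuous z Hz d3 Hd3) as [d4 [Hd4 [_ H4]]].
  destruct (sqrt_slit_domain_open al A B t z Hal HAB HD) as [d5 [Hd5 H5]].
  assert (Hm : 0 < Rmin d2 (Rmin d4 d5)) by (repeat apply Rmin_glb_lt; assumption).
  exists (mkposreal _ Hm). intros z' Hz'.
  change (Cmod (z' - z)%C < Rmin d2 (Rmin d4 d5)) in Hz'.
  change (Cmod (sqrt_flow al A B z' t - w - (z' - z) * (/ z / l))%C <= eps * Cmod (z' - z)%C).
  set (k := (z' - z)%C) in *.
  assert (Q1 := Rmin_l d2 (Rmin d4 d5)). assert (Q2 := Rmin_r d2 (Rmin d4 d5)).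
  assert (Q3 := Rmin_l d4 d5). assert (Q4 := Rmin_r d4 d5).
  assert (Ez : (z + k = z')%C) by (unfold k; ring).
  specialize (H2 k ltac:(lra)). specialize (H4 k ltac:(lra)). specialize (H5 k ltac:(lra)).
  rewrite Ez in H2, H4, H5.
  destruct (sqrt_flow_spec al A B t z' Hal HAB Ht H5) as [Hw' Ew'].
  fold A1 B1 in Ew'.
  set (w' := sqrt_flow al A B z' t) in *. set (D := (w' - w)%C).
  assert (HDd : Cmod D < d1).
  { apply (H3 A1 B1 w'); auto; try (rewrite Rminus_diag, Rabs_R0; exact Hd3).
    rewrite Ew, Ew'. exact H4. }
  specialize (H1 A1 B1 D HDd).
  rewrite Rminus_diag, Rabs_R0 in H1. specialize (H1 Hd1).
  rewrite Rminus_diag, Rabs_R0 in H1. specialize (H1 Hd1).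
  replace (w + D)%C with w' in H1 by (unfold D; ring). rewrite Ew, Ew' in H1.
  replace (RtoC al * ((D - RtoC 0) / (w - RtoC A1)) + RtoC (1 - al) * ((D - RtoC 0) / (w - RtoC B1)))%C
    with (l * D)%C in H1
    by (unfold l, log_mean_slope; field; split; apply upper_neq0; now apply upper_minus_R).
  replace (D - k * (/ z / l))%C with (D - (/ z) / l * k)%C by ring.
  apply HI.
  replace (l * D - / z * k)%C with
    ((Clog z' - Clog z - k / z) + - (Clog z' - Clog z - l * D))%C
    by (field; now apply upper_neq0).
  eapply Rle_trans; [apply Cmod_triangle|]. rewrite Cmod_opp. lra.
Qed.

Lemma log_mean_exp (al A B : R) (w : C) : 0 < al < 1 ->
  let z := Cpolar (exp (Re (log_mean al A B w))) (Im (log_mean al A B w)) in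
  upper_half_plane z /\ Clog z = log_mean al A B w.
Proof.
  intros Hal z.
  assert (Hi : 0 < Im (log_mean al A B w) < PI).
  { rewrite Im_log_mean. assert (P1 := Carg_bound (w - RtoC A)%C).
    assert (P2 := Carg_bound (w - RtoC B)%C). nra. }
  split.
  - apply Cpolar_upper; [apply exp_pos|exact Hi].
  - unfold z. rewrite Clog_polar; [|apply exp_pos|exact Hi]. rewrite ln_exp.
    now destruct (log_mean al A B w).
Qed.

(** The inverse of the flow map is explicit, the exponential of [log_mean]; surjectivity and all
    boundary values are read from it. *)
Lemma log_mean_exp_domain (al A B t : R) (w : C) : 0 < al < 1 -> B < A -> 0 < t ->
  upper_half_plane w ->
  let L := log_mean al (A * sqrt t) (B * sqrt t) w in
  slit_domain (sqrt_slit al A B t) (Cpolar (exp (Re L)) (Im L)) /\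
  sqrt_flow al A B (Cpolar (exp (Re L)) (Im L)) t = w.
Proof.
  intros Hal HAB Ht Hw L. assert (P := sqrt_lt_R0 t Ht).
  destruct (log_mean_exp al (A * sqrt t) (B * sqrt t) w Hal) as [Hz Ez].
  fold L in Hz, Ez.
  split; [|now apply sqrt_flow_eq].
  apply sqrt_slit_domain_iff; auto. split; [exact Hz|]. intros Harg.
  assert (Hi : Im L = PI * al) by (rewrite <- Ez; exact Harg).
  assert (H := log_mean_avoids_slit al (A * sqrt t) (B * sqrt t) w Hal ltac:(nra) Hw Hi).
  rewrite <- ln_slit_radius in H by assumption. fold L in H.
  rewrite Cmod_polar by (left; apply exp_pos).
  rewrite <- (exp_ln (slit_radius al A B t)) by now apply slit_radius_pos.
  now apply exp_increasing.
Qed.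

Lemma sqrt_flow_conformal (al A B t : R) : 0 < al < 1 -> B < A -> 0 < t ->
  conformal_onto (fun z => sqrt_flow al A B z t) (slit_domain (sqrt_slit al A B t))
    upper_half_plane.
Proof.
  intros Hal HAB Ht. split; [|split; [|split]].
  - intros z Hz. apply sqrt_flow_holomorphic; auto. lra.
  - intros z z' Hz Hz' E.
    destruct (sqrt_flow_spec al A B t z Hal HAB (Rlt_le _ _ Ht) Hz) as [_ E1].
    destruct (sqrt_flow_spec al A B t z' Hal HAB (Rlt_le _ _ Ht) Hz') as [_ E2].
    apply Clog_inj; [apply Hz|apply Hz'|]. rewrite <- E1, <- E2, E. reflexivity.
  - intros z Hz. apply sqrt_flow_spec; auto. lra.
  - intros q Hq. eexists. apply (log_mean_exp_domain al A B t q Hal HAB Ht Hq).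
Qed.

(** * The explicit flow as a function of time *)

Lemma sqrt_half_holder (r s : R) : 0 <= r -> 0 <= s ->
  Rabs (sqrt r - sqrt s) <= sqrt (Rabs (r - s)).
Proof.
  assert (W : forall r s, 0 <= s <= r -> Rabs (sqrt r - sqrt s) <= sqrt (Rabs (r - s))).
  { intros a b H. assert (Ha := sqrt_pos a). assert (Hb := sqrt_pos b).
    assert (Hab := sqrt_le_1_alt b a (proj2 H)).
    rewrite Rabs_pos_eq by lra. rewrite Rabs_pos_eq by lra.
    apply Rsqr_incr_0_var; [|apply sqrt_pos].
    rewrite Rsqr_sqrt by lra. unfold Rsqr.
    assert (Ea := sqrt_sqrt a ltac:(lra)). assert (Eb := sqrt_sqrt b ltac:(lra)). nra. }
  intros Hr Hs. destruct (Rle_or_lt s r) as [H|H].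
  - apply W; lra.
  - rewrite Rabs_minus_sym, (Rabs_minus_sym r s). apply W; lra.
Qed.

Lemma sqrt_flow_continuous (al A B t s : R) (z : C) : 0 < al < 1 -> B < A ->
  slit_domain (sqrt_slit al A B t) z -> 0 <= s <= t ->
  forall eps, 0 < eps -> exists del, 0 < del /\ forall r, 0 <= r <= t ->
  Rabs (r - s) < del -> Cmod (sqrt_flow al A B z r - sqrt_flow al A B z s)%C < eps.
Proof.
  intros Hal HAB HD Hs eps He.
  assert (HDr : forall r, 0 <= r <= t -> slit_domain (sqrt_slit al A B r) z).
  { intros r Hr. now apply (sqrt_slit_domain_mono al A B r t). }
  destruct (sqrt_flow_spec al A B s z Hal HAB (proj1 Hs) (HDr s Hs)) as [Hw Ew].
  destruct (log_mean_inverse_continuous al (A * sqrt s) (B * sqrt s) _ Hal Hw eps He)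
    as [d [Hd H]].
  set (K := Rabs A + Rabs B + 1).
  assert (PA := Rabs_pos A). assert (PB := Rabs_pos B).
  assert (HdK : 0 < d / K) by (apply Rdiv_lt_0_compat; unfold K; lra).
  (* The square compensates for the exponent 1/2 of [sqrt], so that [s = 0] is covered. *)
  exists ((d / K) ^ 2). split; [nra|]. intros r Hr Hrs.
  destruct (sqrt_flow_spec al A B r z Hal HAB (proj1 Hr) (HDr r Hr)) as [Hw' Ew'].
  assert (Hsq : Rabs (sqrt r - sqrt s) < d / K).
  { eapply Rle_lt_trans; [apply sqrt_half_holder; lra|].
    rewrite <- (sqrt_pow2 (d / K)) by lra. apply sqrt_lt_1_alt.
    split; [apply Rabs_pos|exact Hrs]. }
  apply Rlt_div_r in Hsq; [|unfold K; lra].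
  assert (Pq := Rabs_pos (sqrt r - sqrt s)).
  apply (H (A * sqrt r) (B * sqrt r)); auto.
  - rewrite <- Rmult_minus_distr_l, Rabs_mult. unfold K in Hsq. nra.
  - rewrite <- Rmult_minus_distr_l, Rabs_mult. unfold K in Hsq. nra.
  - rewrite Ew, Ew'. replace (Clog z - Clog z)%C with (RtoC 0) by ring. now rewrite Cmod_0.
Qed.

Lemma sqrt_increment (r s : R) : 0 < s -> 0 <= r ->
  Rabs (sqrt r - sqrt s) <= Rabs (r - s) / sqrt s /\
  Rabs (sqrt r - sqrt s - (r - s) / (2 * sqrt s)) <= Rabs (r - s) ^ 2 / (2 * sqrt s ^ 3).
Proof.
  intros Hs Hr. assert (Ps := sqrt_lt_R0 s Hs). assert (Pr := sqrt_pos r).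
  assert (Es := sqrt_sqrt s ltac:(lra)). assert (Er := sqrt_sqrt r Hr).
  set (a := sqrt r) in *. set (b := sqrt s) in *.
  rewrite <- Es, <- Er.
  assert (E1 : a * a - b * b = (a - b) * (a + b)) by ring.
  rewrite E1, Rabs_mult, (Rabs_pos_eq (a + b)) by lra.
  assert (P := Rabs_pos (a - b)). split.
  - apply Rle_div_r; [exact Ps|]. nra.
  - replace (a - b - (a - b) * (a + b) / (2 * b)) with (- ((a - b) * (a - b) / (2 * b)))
      by (field; lra).
    rewrite Rabs_Ropp. unfold Rdiv at 1. rewrite !Rabs_mult, Rabs_inv, (Rabs_pos_eq (2 * b)) by lra.
    replace (Rabs (a - b) * Rabs (a - b) * / (2 * b)) with
      (Rabs (a - b) * Rabs (a - b) * (b * b) / (2 * b ^ 3)) by (field; lra).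
    apply Rmult_le_compat_r.
    + left. apply Rinv_0_lt_compat. assert (0 < b ^ 3) by now apply pow_lt. lra.
    + replace ((Rabs (a - b) * (a + b)) ^ 2) with
        (Rabs (a - b) * Rabs (a - b) * ((a + b) * (a + b))) by ring.
      apply Rmult_le_compat_l; nra.
Qed.

(** Implicit differentiation at fixed [z]: the singularities move with [sqrt s], so
    [l * dw = n * d(sqrt s)], and [m = n / (2 * sqrt s)] by the chain rule. The quotient [m / l] is
    the Loewner velocity. *)
Lemma sqrt_flow_time_derivative (al A B t s : R) (z : C) : 0 < al < 1 -> B < A ->
  al * A + (1 - al) * B = 0 -> A * B = - 4 ->
  slit_domain (sqrt_slit al A B t) z -> 0 < s <= t ->
  forall eps, 0 < eps -> exists del, 0 < del /\ forall r, 0 <= r <= t ->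
  Rabs (r - s) < del ->
  Cmod (sqrt_flow al A B z r - sqrt_flow al A B z s -
    RtoC (r - s) * (RtoC 2 / (sqrt_flow al A B z s - RtoC ((A + B) * sqrt s))))%C
  <= eps * Rabs (r - s).
Proof.
  intros Hal HAB Hmean Hprod HD Hs eps He.
  assert (HDr : forall r, 0 <= r <= t -> slit_domain (sqrt_slit al A B r) z).
  { intros r Hr. now apply (sqrt_slit_domain_mono al A B r t). }
  destruct (sqrt_flow_spec al A B s z Hal HAB ltac:(lra) (HDr s ltac:(lra))) as [Hw Ew].
  set (w := sqrt_flow al A B z s) in *.
  assert (Ps := sqrt_lt_R0 s (proj1 Hs)).
  set (sg := sqrt s) in *.
  assert (HwA := upper_neq0 _ (upper_minus_R w (A * sg) Hw)).
  assert (HwB := upper_neq0 _ (upper_minus_R w (B * sg) Hw)).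
  assert (HwC := upper_neq0 _ (upper_minus_R w ((A + B) * sg) Hw)).
  set (l := log_mean_slope al (A * sg) (B * sg) w).
  set (n := (RtoC al * RtoC A / (w - RtoC (A * sg)) + RtoC (1 - al) * RtoC B / (w - RtoC (B * sg)))%C).
  set (m := (n / RtoC (2 * sg))%C).
  assert (Hl : l <> RtoC 0) by now apply log_mean_slope_neq0.
  assert (Hsg0 : RtoC sg <> RtoC 0) by (intros E; apply RtoC_inj in E; lra).
  assert (H2 : RtoC 2 <> RtoC 0) by (intros E; apply RtoC_inj in E; lra).
  (* The vanishing mean [al * A + (1 - al) * B] makes the zero of the slope the driving point
     [(A + B) * sg]; in the numerator of [n] it kills the term in [w], leaving
     [- A * B * sg = 4 * sg]. *)
  assert (El : (l * ((w - RtoC (A * sg)) * (w - RtoC (B * sg))) = w - RtoC ((A + B) * sg))%C).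
  { transitivity (w - RtoC ((A + B) * sg) + RtoC ((al * A + (1 - al) * B) * sg))%C.
    - unfold l, log_mean_slope. rewrite !RtoC_mult, !RtoC_plus, !RtoC_mult, !RtoC_minus.
      rewrite !RtoC_mult in HwA, HwB. field. split; assumption.
    - rewrite Hmean, Rmult_0_l. ring. }
  assert (En : (n * ((w - RtoC (A * sg)) * (w - RtoC (B * sg))) = RtoC (4 * sg))%C).
  { transitivity (RtoC (al * A + (1 - al) * B) * w - RtoC (A * B * sg))%C.
    - unfold n. rewrite !RtoC_plus, !RtoC_mult, !RtoC_minus.
      rewrite !RtoC_mult in HwA, HwB. field. split; assumption.
    - rewrite Hmean, Hprod. replace (-4 * sg) with (- (4 * sg)) by ring. rewrite RtoC_opp. ring. }
  assert (Eml : (m / l = RtoC 2 / (w - RtoC ((A + B) * sg)))%C).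
  { rewrite <- El. unfold m.
    transitivity (n * ((w - RtoC (A * sg)) * (w - RtoC (B * sg))) / RtoC (2 * sg) /
      (l * ((w - RtoC (A * sg)) * (w - RtoC (B * sg)))))%C.
    - rewrite !RtoC_mult. rewrite !RtoC_mult in HwA, HwB. field. repeat split; assumption.
    - rewrite En. rewrite !RtoC_mult. rewrite !RtoC_mult in HwA, HwB.
      replace (RtoC 4) with (RtoC 2 * RtoC 2)%C by (rewrite <- RtoC_mult; f_equal; ring).
      field. repeat split; assumption. }
  destruct (implicit_slope l m eps Hl He) as [e [He' HI]].
  assert (PA := Rabs_pos A). assert (PB := Rabs_pos B).
  set (K := 1 + (Rabs A + Rabs B) / sg).
  assert (HK : 1 <= K).
  { unfold K. assert (0 <= (Rabs A + Rabs B) / sg) by (apply Rdiv_le_0_compat; lra). lra. }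
  set (e1 := e / (2 * K)).
  assert (He1 : 0 < e1) by (apply Rdiv_lt_0_compat; lra).
  destruct (log_mean_differentiable al (A * sg) (B * sg) w Hal Hw e1 He1) as [d1 [Hd1 H1]].
  destruct (sqrt_flow_continuous al A B t s z Hal HAB HD ltac:(lra) d1 Hd1) as [d2 [Hd2 H2']].
  set (N := Cmod n / (2 * sg ^ 3)).
  assert (Psg3 : 0 < sg ^ 3) by now apply pow_lt.
  assert (HN : 0 <= N) by (apply Rdiv_le_0_compat; [apply Cmod_ge_0|lra]).
  (* [d3] keeps the parameter shifts below [d1], and [d4] makes the quadratic remainder of [sqrt] at
     most [e / 2] times the time increment. *)
  set (d3 := d1 * sg / (1 + Rabs A + Rabs B)).
  assert (Hd3 : 0 < d3) by (apply Rdiv_lt_0_compat; nra).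
  set (d4 := e / (2 * (1 + N))).
  assert (Hd4 : 0 < d4) by (apply Rdiv_lt_0_compat; lra).
  exists (Rmin (Rmin d2 d3) d4). split; [repeat apply Rmin_glb_lt; assumption|].
  intros r Hr Hrs.
  assert (Q1 := Rmin_l (Rmin d2 d3) d4). assert (Q2 := Rmin_r (Rmin d2 d3) d4).
  assert (Q3 := Rmin_l d2 d3). assert (Q4 := Rmin_r d2 d3).
  specialize (H2' r Hr ltac:(lra)).
  destruct (sqrt_flow_spec al A B r z Hal HAB ltac:(lra) (HDr r Hr)) as [Hw' Ew'].
  set (w' := sqrt_flow al A B z r) in *. fold w in H2'.
  set (D := (w' - w)%C) in *.
  destruct (sqrt_increment r s ltac:(lra) ltac:(lra)) as [I1 I2]. fold sg in I1, I2.
  set (ds := sqrt r - sg) in *. set (k := r - s) in *.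
  assert (Pk := Rabs_pos k). assert (Pds := Rabs_pos ds).
  assert (EA : A * sqrt r - A * sg = A * ds) by (unfold ds; ring).
  assert (EB : B * sqrt r - B * sg = B * ds) by (unfold ds; ring).
  assert (Hds : Rabs ds * sg <= Rabs k) by (apply Rle_div_r in I1; assumption).
  assert (Hk3 : Rabs k * (1 + Rabs A + Rabs B) < d1 * sg).
  { assert (P : Rabs k < d3) by lra. unfold d3 in P. apply Rlt_div_r in P; [exact P|lra]. }
  specialize (H1 (A * sqrt r) (B * sqrt r) D H2').
  rewrite EA, EB, !Rabs_mult in H1.
  assert (HA1 : Rabs A * Rabs ds < d1).
  { apply (Rmult_lt_reg_r sg); [exact Ps|]. nra. }
  assert (HB1 : Rabs B * Rabs ds < d1).
  { apply (Rmult_lt_reg_r sg); [exact Ps|]. nra. }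
  specialize (H1 HA1 HB1).
  replace (w + D)%C with w' in H1 by (unfold D; ring).
  rewrite Ew, Ew' in H1.
  assert (Es : (Clog z - Clog z - (RtoC al * ((D - RtoC (A * ds)) / (w - RtoC (A * sg)))
     + RtoC (1 - al) * ((D - RtoC (B * ds)) / (w - RtoC (B * sg)))) = - (l * D - n * RtoC ds))%C).
  { unfold l, n, log_mean_slope. rewrite !RtoC_mult. rewrite !RtoC_mult in HwA, HwB.
    field. split; assumption. }
  rewrite Es, Cmod_opp in H1.
  change (Cmod (D - RtoC k * (RtoC 2 / (w - RtoC ((A + B) * sg))))%C <= eps * Rabs k).
  rewrite <- Eml. replace (D - RtoC k * (m / l))%C with (D - m / l * RtoC k)%C by ring.
  rewrite <- (Cmod_R k). apply HI. rewrite (Cmod_R k).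
  replace (l * D - m * RtoC k)%C with
    ((l * D - n * RtoC ds) + n * RtoC (ds - k / (2 * sg)))%C.
  2:{ unfold m. rewrite !RtoC_minus, RtoC_div, !RtoC_mult by lra. field. repeat split; assumption. }
  eapply Rle_trans; [apply Cmod_triangle|]. rewrite Cmod_mult, Cmod_R.
  assert (B1 : e1 * (Cmod D + Rabs A * Rabs ds + Rabs B * Rabs ds) <= e / 2 * (Cmod D + Rabs k)).
  { assert (HDs : Cmod D + Rabs A * Rabs ds + Rabs B * Rabs ds <= K * (Cmod D + Rabs k)).
    { assert (P := Cmod_ge_0 D).
      assert (Rabs A * Rabs ds + Rabs B * Rabs ds <= (Rabs A + Rabs B) / sg * Rabs k).
      { replace ((Rabs A + Rabs B) / sg * Rabs k) with ((Rabs A + Rabs B) * (Rabs k / sg))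
          by (field; lra).
        rewrite <- Rmult_plus_distr_r. apply Rmult_le_compat_l; [lra|exact I1]. }
      assert (0 <= (Rabs A + Rabs B) / sg * Cmod D).
      { apply Rmult_le_pos; [apply Rdiv_le_0_compat; lra|exact P]. }
      unfold K. lra. }
    replace (e / 2) with (e1 * K) by (unfold e1; field; lra).
    rewrite Rmult_assoc. apply Rmult_le_compat_l; [lra|exact HDs]. }
  assert (B2 : Cmod n * Rabs (ds - k / (2 * sg)) <= e / 2 * Rabs k).
  { apply (Rle_trans _ (N * Rabs k * Rabs k)).
    - replace (N * Rabs k * Rabs k) with (Cmod n * (Rabs k ^ 2 / (2 * sg ^ 3)))
        by (unfold N; field; lra).
      apply Rmult_le_compat_l; [apply Cmod_ge_0|exact I2].
    - apply Rmult_le_compat_r; [exact Pk|].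
      assert (P : Rabs k < d4) by lra. unfold d4 in P.
      apply Rlt_div_r in P; [|lra]. nra. }
  assert (P := Cmod_ge_0 D). nra.
Qed.

(** Implicit differentiation breaks down at time 0, where the parameters have infinite speed. The
    velocity at positive times nevertheless tends to [2 / z], and the mean value theorem on [[0, r]]
    carries this to the endpoint. *)
Lemma sqrt_flow_initial_derivative (al A B t : R) (z : C) : 0 < al < 1 -> B < A ->
  al * A + (1 - al) * B = 0 -> A * B = - 4 -> 0 < t ->
  slit_domain (sqrt_slit al A B t) z ->
  forall eps, 0 < eps -> exists del, 0 < del /\ forall r, 0 <= r <= t ->
  Rabs (r - 0) < del ->
  Cmod (sqrt_flow al A B z r - z - RtoC (r - 0) * (RtoC 2 / z))%C <= eps * Rabs (r - 0).
Proof.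
  intros Hal HAB Hmean Hprod Ht HD eps He.
  assert (Hz : upper_half_plane z) by apply HD.
  assert (Hmz := Cmod_upper z Hz).
  pose (V := fun s => (RtoC 2 / (sqrt_flow al A B z s - RtoC ((A + B) * sqrt s)))%C).
  assert (HC : forall s, 0 <= s <= t -> forall eps, 0 < eps -> exists del, 0 < del /\
    forall r, 0 <= r <= t -> Rabs (r - s) < del ->
    Cmod (sqrt_flow al A B z r - sqrt_flow al A B z s)%C < eps).
  { intros s Hs. now apply sqrt_flow_continuous. }
  assert (HV : forall s, 0 < s < t -> forall eps, 0 < eps -> exists del, 0 < del /\
    forall r, 0 <= r <= t -> Rabs (r - s) < del ->
    Cmod (sqrt_flow al A B z r - sqrt_flow al A B z s - RtoC (r - s) * V s)%C
      <= eps * Rabs (r - s)).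
  { intros s Hs. apply sqrt_flow_time_derivative; auto. lra. }
  assert (EC : forall s r, Re (sqrt_flow al A B z r - sqrt_flow al A B z s - RtoC (r - s) * V s)%C
      = Re (sqrt_flow al A B z r) - Re (sqrt_flow al A B z s) - (r - s) * Re (V s) /\
     Im (sqrt_flow al A B z r - sqrt_flow al A B z s - RtoC (r - s) * V s)%C
      = Im (sqrt_flow al A B z r) - Im (sqrt_flow al A B z s) - (r - s) * Im (V s)).
  { intros s r. generalize (sqrt_flow al A B z r) (sqrt_flow al A B z s) (V s).
    intros [] [] []. cbn. split; ring. }
  destruct (extend_path_component t (fun s => Re (sqrt_flow al A B z s)) (fun s => Re (V s)) Ht)
    as [u [Eu [Cu Du]]].
  { intros s Hs e He'. destruct (HC s Hs e He') as [d [Hd H]]. exists d. split; [exact Hd|].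
    intros r Hr Hrs. eapply Rle_lt_trans; [|exact (H r Hr Hrs)].
    exact (re_le_Cmod (sqrt_flow al A B z r - sqrt_flow al A B z s)%C). }
  { intros s Hs e He'. destruct (HV s Hs e He') as [d [Hd H]]. exists d. split; [exact Hd|].
    intros r Hr Hrs. rewrite <- (proj1 (EC s r)).
    eapply Rle_trans; [apply re_le_Cmod|exact (H r Hr Hrs)]. }
  destruct (extend_path_component t (fun s => Im (sqrt_flow al A B z s)) (fun s => Im (V s)) Ht)
    as [v [Ev [Cv Dv]]].
  { intros s Hs e He'. destruct (HC s Hs e He') as [d [Hd H]]. exists d. split; [exact Hd|].
    intros r Hr Hrs. eapply Rle_lt_trans; [|exact (H r Hr Hrs)].
    exact (Im_abs_le (sqrt_flow al A B z r - sqrt_flow al A B z s)%C). }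
  { intros s Hs e He'. destruct (HV s Hs e He') as [d [Hd H]]. exists d. split; [exact Hd|].
    intros r Hr Hrs. rewrite <- (proj2 (EC s r)).
    eapply Rle_trans; [apply Im_abs_le|exact (H r Hr Hrs)]. }
  assert (E0 : sqrt_flow al A B z 0 = z) by now apply sqrt_flow_0.
  (* If [a], the denominator of [V s], is within [eta] of [z], then [Cmod a >= Cmod z / 2] and
     [2 / a] differs from [2 / z] by at most [4 * eta / Cmod z ^ 2 <= eps / 2]. *)
  set (eta := Rmin (Cmod z / 2) (eps * Cmod z ^ 2 / 8)).
  assert (Heta : 0 < eta).
  { apply Rmin_glb_lt; [lra|]. assert (0 < Cmod z ^ 2) by nra. nra. }
  assert (Heta1 : eta <= Cmod z / 2) by apply Rmin_l.
  assert (Heta2 : eta <= eps * Cmod z ^ 2 / 8) by apply Rmin_r.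
  destruct (HC 0 ltac:(lra) (eta / 2) ltac:(lra)) as [d1 [Hd1 H1]].
  set (K := 2 * (1 + Rabs (A + B))).
  assert (HK : 0 < K) by (unfold K; assert (P := Rabs_pos (A + B)); lra).
  assert (HeK : 0 < eta / K) by now apply Rdiv_lt_0_compat.
  exists (Rmin d1 ((eta / K) ^ 2)). split; [apply Rmin_glb_lt; [exact Hd1|nra]|].
  intros r Hr Hrd. rewrite Rminus_0_r in Hrd |- *.
  rewrite Rabs_pos_eq in Hrd |- * by lra.
  assert (Q1 := Rmin_l d1 ((eta / K) ^ 2)). assert (Q2 := Rmin_r d1 ((eta / K) ^ 2)).
  destruct (Rle_lt_or_eq_dec 0 r (proj1 Hr)) as [Hr0|<-].
  2:{ rewrite E0. replace (z - z - RtoC 0 * (RtoC 2 / z))%C with (RtoC 0) by ring.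
      rewrite Cmod_0. lra. }
  assert (HB : forall s, 0 < s < r -> Cmod (V s - RtoC 2 / z)%C <= eps / 2).
  { intros s Hs.
    assert (Hws : upper_half_plane (sqrt_flow al A B z s)).
    { apply sqrt_flow_spec; auto; [lra|]. apply (sqrt_slit_domain_mono al A B s t); auto; lra. }
    specialize (H1 s ltac:(lra)). rewrite Rminus_0_r, Rabs_pos_eq, E0 in H1 by lra.
    specialize (H1 ltac:(lra)).
    assert (Hsq : sqrt s < eta / K).
    { rewrite <- (sqrt_pow2 (eta / K)) by lra. apply sqrt_lt_1_alt. lra. }
    apply Rlt_div_r in Hsq; [|exact HK].
    set (a := (sqrt_flow al A B z s - RtoC ((A + B) * sqrt s))%C) in *.
    assert (Ha : upper_half_plane a) by now apply upper_minus_R.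
    assert (Haz : Cmod (z - a)%C <= eta).
    { replace (z - a)%C with (- (sqrt_flow al A B z s - z) + RtoC ((A + B) * sqrt s))%C
        by (unfold a; ring).
      eapply Rle_trans; [apply Cmod_triangle|].
      rewrite Cmod_opp, Cmod_R, Rabs_mult, (Rabs_pos_eq (sqrt s)) by apply sqrt_pos.
      unfold K in Hsq. assert (P := sqrt_pos s). nra. }
    assert (Ham : Cmod z / 2 <= Cmod a).
    { assert (P := Cmod_triangle (z - a)%C a). replace (z - a + a)%C with z in P by ring. lra. }
    replace (V s - RtoC 2 / z)%C with (RtoC 2 * (z - a) / (a * z))%C.
    2:{ unfold V. fold a. field. split; now apply upper_neq0. }
    rewrite Cmod_div by (apply Cmult_neq_0; now apply upper_neq0).
    rewrite !Cmod_mult, Cmod_R, Rabs_pos_eq by lra.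
    apply Rle_div_l; [nra|]. nra. }
  destruct (mean_value u (fun s => Re (V s)) 0 r Hr0) as [s1 [Hs1 M1]].
  { intros x _. apply Cu. }
  { intros x Hx. apply Du. lra. }
  destruct (mean_value v (fun s => Im (V s)) 0 r Hr0) as [s2 [Hs2 M2]].
  { intros x _. apply Cv. }
  { intros x Hx. apply Dv. lra. }
  rewrite (Eu r Hr), (Eu 0 ltac:(lra)), E0 in M1.
  rewrite (Ev r Hr), (Ev 0 ltac:(lra)), E0 in M2.
  eapply Rle_trans; [apply Cmod_le_Re_Im|].
  assert (R1 : Re (sqrt_flow al A B z r - z - RtoC r * (RtoC 2 / z))%C =
     r * Re (V s1 - RtoC 2 / z)%C).
  { transitivity (Re (sqrt_flow al A B z r) - Re z - r * Re (RtoC 2 / z)%C).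
    - generalize (RtoC 2 / z)%C (sqrt_flow al A B z r). intros [] []. destruct z. cbn. ring.
    - rewrite M1. generalize (RtoC 2 / z)%C (V s1). intros [] []. cbn. ring. }
  assert (R2 : Im (sqrt_flow al A B z r - z - RtoC r * (RtoC 2 / z))%C =
     r * Im (V s2 - RtoC 2 / z)%C).
  { transitivity (Im (sqrt_flow al A B z r) - Im z - r * Im (RtoC 2 / z)%C).
    - generalize (RtoC 2 / z)%C (sqrt_flow al A B z r). intros [] []. destruct z. cbn. ring.
    - rewrite M2. generalize (RtoC 2 / z)%C (V s2). intros [] []. cbn. ring. }
  rewrite R1, R2, !Rabs_mult, !(Rabs_pos_eq r) by lra.
  assert (G1 := Rle_trans _ _ _ (re_le_Cmod _) (HB s1 Hs1)).
  assert (G2 := Rle_trans _ _ _ (Im_abs_le _) (HB s2 Hs2)).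
  nra.
Qed.

Lemma sqrt_flow_loewner (al A B t : R) (z : C) : 0 < al < 1 -> B < A ->
  al * A + (1 - al) * B = 0 -> A * B = - 4 -> 0 < t ->
  slit_domain (sqrt_slit al A B t) z ->
  loewner_solution (fun s => (A + B) * sqrt s) z t (sqrt_flow al A B z).
Proof.
  intros Hal HAB Hmean Hprod Ht HD.
  assert (Hz : upper_half_plane z) by apply HD.
  split; [now apply sqrt_flow_0|]. intros s Hs.
  assert (Hw : upper_half_plane (sqrt_flow al A B z s)).
  { apply sqrt_flow_spec; auto; [lra|]. now apply (sqrt_slit_domain_mono al A B s t). }
  split.
  - intros E. rewrite E in Hw. unfold upper_half_plane in Hw. simpl in Hw. lra.
  - apply filterdiff_path_iff; [exact Hs|].
    destruct (Rle_lt_or_eq_dec 0 s (proj1 Hs)) as [Hs0|<-].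
    + apply sqrt_flow_time_derivative; auto. lra.
    + rewrite sqrt_flow_0, sqrt_0, Rmult_0_r by assumption.
      replace (z - RtoC 0)%C with z by ring.
      now apply sqrt_flow_initial_derivative.
Qed.

(** * The straight slits are quasislits *)

Lemma Cmod_lipschitz_continuous (f : C -> C) (K : R) : 0 <= K ->
  (forall z z', Cmod (f z - f z')%C <= K * Cmod (z - z')%C) ->
  forall z, continuous (T := C_UniformSpace) (U := C_UniformSpace) f z.
Proof.
  intros HK H z. apply filterlim_locally. intros eps.
  (* Balls of [C_UniformSpace] are squares; [sqrt 2] compares them with discs. *)
  assert (H2 : 0 < sqrt 2) by (apply sqrt_lt_R0; lra).
  assert (Hd : 0 < eps / (sqrt 2 * (K + 1))).
  { apply Rdiv_lt_0_compat; [apply cond_pos|]. apply Rmult_lt_0_compat; lra. }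
  exists (mkposreal _ Hd). intros z' Hz'.
  apply C_NormedModule_mixin_compat1.
  apply C_NormedModule_mixin_compat2 in Hz'. simpl pos in Hz'.
  change (Cmod (z' - z)%C < sqrt 2 * (eps / (sqrt 2 * (K + 1)))) in Hz'.
  change (Cmod (f z' - f z)%C < eps).
  replace (sqrt 2 * (eps / (sqrt 2 * (K + 1)))) with (eps / (K + 1)) in Hz' by (field; lra).
  apply Rlt_div_r in Hz'; [|lra].
  assert (P := H z' z). assert (P2 := Cmod_ge_0 (z' - z)%C). lra.
Qed.

Lemma stretch_similarity (f : C -> C) (q r : R) (z : C) : 0 < r ->
  (forall z z', Cmod (f z - f z')%C = q * Cmod (z - z')%C) ->
  max_stretch f z r = q * r /\ min_stretch f z r = q * r.
Proof.
  intros Hr Hf. unfold max_stretch, min_stretch.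
  assert (Hex : exists w, Cmod (w - z)%C = r /\ q * r = Cmod (f w - f z)%C).
  { exists (z + RtoC r)%C. rewrite Hf.
    replace (z + RtoC r - z)%C with (RtoC r) by ring.
    rewrite Cmod_R, Rabs_pos_eq by lra. tauto. }
  assert (Hall : forall y, (exists w, Cmod (w - z)%C = r /\ y = Cmod (f w - f z)%C) -> y = q * r).
  { intros y [w [E ->]]. now rewrite Hf, E. }
  split.
  - rewrite (is_lub_Rbar_unique _ (Finite (q * r))); [reflexivity|]. split.
    + intros y Hy. rewrite (Hall y Hy). apply Rle_refl.
    + intros b Hb. now apply Hb.
  - rewrite (is_glb_Rbar_unique _ (Finite (q * r))); [reflexivity|]. split.
    + intros y Hy. rewrite (Hall y Hy). apply Rle_refl.
    + intros b Hb. now apply Hb.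
Qed.

Lemma Cmult_quasiconformal (e : C) : e <> RtoC 0 -> quasiconformal (fun z => e * z)%C.
Proof.
  intros He. assert (Hm : 0 < Cmod e) by now apply Cmod_gt_0.
  assert (Hf : forall z z', Cmod (e * z - e * z')%C = Cmod e * Cmod (z - z')%C).
  { intros z z'. rewrite <- Cmod_mult. f_equal. ring. }
  split; [split|].
  - apply (Cmod_lipschitz_continuous _ (Cmod e)); [lra|]. intros. rewrite Hf. lra.
  - exists (fun z => / e * z)%C. split; [|split].
    + apply (Cmod_lipschitz_continuous _ (Cmod (/ e)%C)); [apply Cmod_ge_0|].
      intros z z'. rewrite <- Cmod_mult. right. f_equal. ring.
    + intros z. field. exact He.
    + intros z. field. exact He.
  - exists 1. intros z. apply limsup_right_le with 1; [lra|]. intros r Hr.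
    destruct (stretch_similarity (fun z => e * z)%C (Cmod e) r z ltac:(lra) Hf) as [-> ->].
    right. field. nra.
Qed.

Lemma Cpolar_scale (s r th : R) : Cpolar (s * r) th = (Cpolar r th * RtoC s)%C.
Proof. unfold Cpolar. apply injective_projections; cbn; ring. Qed.

Lemma sqrt_slit_jordan (al A B t : R) : 0 < al < 1 -> B < A -> 0 < t ->
  jordan_slit 0 (sqrt_slit al A B t).
Proof.
  intros Hal HAB Ht. assert (Hr := slit_radius_pos al A B t HAB Ht).
  assert (Hpi := PI_mult_bound al Hal).
  assert (Hs := sin_gt_0 _ (proj1 Hpi) (proj2 Hpi)).
  exists (fun s => Cpolar (s * slit_radius al A B t) (PI * al)).
  split; [|split; [|split; [|split]]].
  - intros s _ P [eps HP].
    assert (HF : forall q, locally s (fun y => ball (s * slit_radius al A B t * q) eps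
       (y * slit_radius al A B t * q))).
    { intros q. apply (proj1 (filterlim_locally (fun y => y * slit_radius al A B t * q) _)).
      apply (ex_derive_continuous (K := R_AbsRing) (V := R_NormedModule)
        (fun y => y * slit_radius al A B t * q)). auto_derive. exact I. }
    unfold filtermap, within.
    generalize (filter_and _ _ (HF (cos (PI * al))) (HF (sin (PI * al)))).
    apply filter_imp. intros y [H1 H2] _. apply HP. split; assumption.
  - intros s s' Hs1 Hs2 E. assert (E2 := f_equal Im E). simpl in E2.
    apply Rmult_eq_reg_r in E2; [|lra]. apply Rmult_eq_reg_r in E2; lra.
  - unfold Cpolar. apply injective_projections; simpl; ring.
  - intros s Hs1. apply Cpolar_upper; [nra|exact Hpi].
  - intros z. reflexivity.
Qed.

(** The slit is the image of [[0, 1]] under multiplication by its tip, a similarity, and it lies on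
    a ray with [Rabs (Re z) / Im z] constant. *)
Lemma sqrt_slit_quasislit (al A B t : R) : 0 < al < 1 -> B < A -> 0 < t ->
  quasislit 0 (sqrt_slit al A B t).
Proof.
  intros Hal HAB Ht. assert (Hr := slit_radius_pos al A B t HAB Ht).
  assert (Hpi := PI_mult_bound al Hal).
  assert (Hs := sin_gt_0 _ (proj1 Hpi) (proj2 Hpi)).
  split; [now apply sqrt_slit_jordan|split].
  - exists (fun z => Cpolar (slit_radius al A B t) (PI * al) * z)%C. split.
    + apply Cmult_quasiconformal, upper_neq0. now apply Cpolar_upper.
    + intros z. unfold sqrt_slit.
      split; intros [s [Hs1 E]]; exists s; (split; [exact Hs1|]); rewrite E.
      * apply Cpolar_scale.
      * symmetry. apply Cpolar_scale.
  - exists (Rabs (cos (PI * al)) / sin (PI * al)).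
    intros z [s [Hs1 E]] Hz.
    assert (Hs0 : 0 < s).
    { destruct (proj1 Hs1) as [|E0]; [easy|]. exfalso. apply Hz. rewrite E, <- E0.
      unfold Cpolar. apply injective_projections; simpl; ring. }
    subst z. split; [apply Cpolar_upper; [nra|exact Hpi]|]. simpl.
    rewrite Rminus_0_r, Rabs_mult, (Rabs_pos_eq (s * _)) by nra.
    right. field. lra.
Qed.

(** * Boundary values of the explicit flow *)

(** Apply [ln q <= q - 1] to [a / (al * (a + b))] and [b / ((1 - al) * (a + b))], with weights [al]
    and [1 - al]; the right-hand sides sum to 0. *)
Lemma weighted_am_gm_ln (al a b : R) : 0 < al < 1 -> 0 < a -> 0 < b ->
  al * ln a + (1 - al) * ln b <= ln (a + b) + al * ln al + (1 - al) * ln (1 - al).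
Proof.
  intros Hal Ha Hb.
  assert (L : forall p x, 0 < p -> 0 < x -> p * ln x <= p * ln (a + b) + p * ln p + (x / (a + b) - p)).
  { intros p x Hp Hx.
    assert (Hq : 0 < x / (p * (a + b))) by (apply Rdiv_lt_0_compat; nra).
    assert (P := exp_ineq1_le (ln (x / (p * (a + b))))). rewrite exp_ln in P by exact Hq.
    rewrite ln_div, ln_mult in P by nra.
    assert (E : p * (x / (p * (a + b))) = x / (a + b)) by (field; lra).
    nra. }
  assert (L1 := L al a ltac:(lra) Ha). assert (L2 := L (1 - al) b ltac:(lra) Hb).
  assert (E : a / (a + b) + b / (a + b) = 1) by (field; lra).
  lra.
Qed.

Lemma Cmod_real_shift (x y a : R) : Cmod ((x, y) - RtoC a)%C = sqrt ((x - a) ^ 2 + y ^ 2).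
Proof. unfold Cmod. cbn. f_equal. ring. Qed.

Lemma Carg_real_shift (x y a : R) : Carg ((x, y) - RtoC a)%C = PI / 2 - atan ((x - a) / y).
Proof. unfold Carg. cbn. replace (y + - 0) with y by ring. reflexivity. Qed.

Lemma atan_div (a y : R) : 0 < a -> 0 < y -> PI / 2 - atan (a / y) = atan (y / a).
Proof.
  intros Ha Hy. replace (y / a) with (/ (a / y)) by (field; lra).
  rewrite atan_inv; [reflexivity|]. now apply Rdiv_lt_0_compat.
Qed.

Lemma sqrt_flow_boundary_interior (al A B t x : R) : 0 < al < 1 -> B < A -> 0 < t ->
  B * sqrt t < x < A * sqrt t ->
  slit_image (sqrt_flow al A B) (sqrt_slit al A B) t x.
Proof.
  intros Hal HAB Ht Hx.
  set (a := A * sqrt t - x). set (b := x - B * sqrt t).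
  assert (Ha : 0 < a) by (unfold a; lra). assert (Hb : 0 < b) by (unfold b; lra).
  assert (Hr := slit_radius_pos al A B t HAB Ht).
  pose (M := fun y => exp (al * ln (sqrt (a ^ 2 + y ^ 2)) + (1 - al) * ln (sqrt (b ^ 2 + y ^ 2)))).
  (* [M y] and [T y] are the modulus and argument of the preimage of [(x, y)]. The arguments are
     written with [y / a] and [y / b], so that they extend smoothly to [y = 0], where the formula of
     [Carg] divides by 0. *)
  pose (T := fun y => al * (PI - atan (y / a)) + (1 - al) * atan (y / b)).
  assert (T0 : T 0 = PI * al).
  { unfold T, Rdiv. rewrite !Rmult_0_l, atan_0. ring. }
  assert (M0 : M 0 = exp (al * ln a + (1 - al) * ln b)).
  { unfold M. replace (a ^ 2 + 0 ^ 2) with (a ^ 2) by ring.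
    replace (b ^ 2 + 0 ^ 2) with (b ^ 2) by ring. rewrite !sqrt_pow2 by lra. reflexivity. }
  (* Weighted AM-GM places the limit of the preimages on the slit itself. *)
  assert (HM0 : M 0 <= slit_radius al A B t).
  { rewrite M0, <- (exp_ln (slit_radius al A B t)) by exact Hr.
    assert (P := weighted_am_gm_ln al a b Hal Ha Hb).
    replace (a + b) with (A * sqrt t - B * sqrt t) in P by (unfold a, b; ring).
    rewrite <- ln_slit_radius in P by assumption.
    destruct P as [P|P]; [left; now apply exp_increasing|right; now rewrite P]. }
  exists (Cpolar (M 0) (T 0)). split.
  { exists (M 0 / slit_radius al A B t). split; [split|].
    - apply Rdiv_le_0_compat; [left; apply exp_pos|exact Hr].
    - apply Rle_div_l; lra.
    - rewrite T0. f_equal. field. lra. }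
  intros eps He.
  assert (Hpa : forall y, 0 < a ^ 2 + y ^ 2) by (intros y; assert (0 < a ^ 2) by nra; nra).
  assert (Hpb : forall y, 0 < b ^ 2 + y ^ 2) by (intros y; assert (0 < b ^ 2) by nra; nra).
  assert (C1 : continuity_pt (fun y => M y * cos (T y)) 0).
  { apply derivable_continuous_pt, ex_derive_Reals_0. unfold M, T. auto_derive.
    repeat split; try (apply sqrt_lt_R0); try apply Hpa; try apply Hpb; lra. }
  assert (C2 : continuity_pt (fun y => M y * sin (T y)) 0).
  { apply derivable_continuous_pt, ex_derive_Reals_0. unfold M, T. auto_derive.
    repeat split; try (apply sqrt_lt_R0); try apply Hpa; try apply Hpb; lra. }
  assert (He2 : 0 < eps / 2) by lra.
  destruct (proj1 (continuity_pt_locally _ _) C1 (mkposreal _ He2)) as [d1 H1].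
  destruct (proj1 (continuity_pt_locally _ _) C2 (mkposreal _ He2)) as [d2 H2].
  assert (P1 := cond_pos d1). assert (P2 := cond_pos d2).
  set (y := Rmin (Rmin d1 d2) eps / 2).
  assert (Q1 := Rmin_l (Rmin d1 d2) eps). assert (Q2 := Rmin_r (Rmin d1 d2) eps).
  assert (Q3 := Rmin_l d1 d2). assert (Q4 := Rmin_r d1 d2).
  assert (Hmin : 0 < Rmin (Rmin d1 d2) eps) by (repeat apply Rmin_glb_lt; assumption).
  assert (Hy : 0 < y) by (unfold y; lra).
  assert (B1 : ball 0 d1 y).
  { change (Rabs (y - 0) < d1). rewrite Rminus_0_r, Rabs_pos_eq; unfold y; lra. }
  assert (B2 : ball 0 d2 y).
  { change (Rabs (y - 0) < d2). rewrite Rminus_0_r, Rabs_pos_eq; unfold y; lra. }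
  specialize (H1 y B1). specialize (H2 y B2). simpl pos in H1, H2.
  assert (Hw : upper_half_plane (x, y)) by exact Hy.
  destruct (log_mean_exp_domain al A B t (x, y) Hal HAB Ht Hw) as [HD EF].
  set (L := log_mean al (A * sqrt t) (B * sqrt t) (x, y)) in *.
  assert (EL1 : exp (Re L) = M y).
  { unfold L, M. rewrite Re_log_mean, !Cmod_real_shift. fold b.
    replace (x - A * sqrt t) with (- a) by (unfold a; ring).
    replace ((- a) ^ 2) with (a ^ 2) by ring. reflexivity. }
  assert (EL2 : Im L = T y).
  { unfold L, T. rewrite Im_log_mean, !Carg_real_shift. fold b.
    replace (x - A * sqrt t) with (- a) by (unfold a; ring).
    rewrite <- (atan_div b y), <- (atan_div a y) by assumption.
    replace (- a / y) with (- (a / y)) by (field; lra). rewrite atan_opp. field. }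
  rewrite EL1, EL2 in HD, EF.
  exists (Cpolar (M y) (T y)). split; [exact HD|split].
  - eapply Rle_lt_trans; [apply Cmod_le_Re_Im|].
    change (Rabs (M y * cos (T y) - M 0 * cos (T 0)) + Rabs (M y * sin (T y) - M 0 * sin (T 0)) < eps).
    lra.
  - rewrite EF, Cmod_real_shift.
    replace ((x - x) ^ 2 + y ^ 2) with (y ^ 2) by ring.
    rewrite sqrt_pow2 by lra. unfold y. lra.
Qed.

Lemma small_weighted_ln (p K eps : R) : 0 < p -> 0 < eps ->
  exists y, 0 < y < eps /\ y <= 1 /\ p * ln y + K < ln eps.
Proof.
  intros Hp He. set (E := (ln eps - 1 - K) / p).
  exists (Rmin (Rmin (eps / 2) 1) (exp E)).
  assert (Q1 := Rmin_l (Rmin (eps / 2) 1) (exp E)). assert (Q2 := Rmin_r (Rmin (eps / 2) 1) (exp E)).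
  assert (Q3 := Rmin_l (eps / 2) 1). assert (Q4 := Rmin_r (eps / 2) 1).
  assert (H0 : 0 < Rmin (Rmin (eps / 2) 1) (exp E)).
  { repeat apply Rmin_glb_lt; try lra. apply exp_pos. }
  repeat split; try lra.
  apply ln_le in Q2; [|exact H0]. rewrite ln_exp in Q2.
  assert (p * E = ln eps - 1 - K) by (unfold E; field; lra). nra.
Qed.

(* Near an end of the interval the logarithm of the modulus has one divergent
   term, of weight [p]. *)
Lemma sqrt_flow_boundary_end (al A B t x p q : R) : 0 < al < 1 -> B < A -> 0 < t ->
  0 < p -> 0 < q ->
  (forall y, 0 < y <= 1 -> Re (log_mean al (A * sqrt t) (B * sqrt t) (x, y)) <=
     p * ln y + q * ln ((A - B) * sqrt t + 1)) ->
  slit_image (sqrt_flow al A B) (sqrt_slit al A B) t x.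
Proof.
  intros Hal HAB Ht Hp Hq H. exists (RtoC 0). split.
  { exists 0. split; [lra|]. unfold Cpolar. apply injective_projections; simpl; ring. }
  intros eps He.
  destruct (small_weighted_ln p (q * ln ((A - B) * sqrt t + 1)) eps Hp He) as [y [Hy [Hy1 HL]]].
  destruct (log_mean_exp_domain al A B t (x, y) Hal HAB Ht (proj1 Hy)) as [HD EF].
  specialize (H y ltac:(lra)).
  set (L := log_mean al (A * sqrt t) (B * sqrt t) (x, y)) in *.
  exists (Cpolar (exp (Re L)) (Im L)). split; [exact HD|split].
  - replace (Cpolar (exp (Re L)) (Im L) - RtoC 0)%C with (Cpolar (exp (Re L)) (Im L)) by ring.
    rewrite Cmod_polar by (left; apply exp_pos).
    rewrite <- (exp_ln eps He). apply exp_increasing. lra.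
  - rewrite EF, Cmod_real_shift.
    replace ((x - x) ^ 2 + y ^ 2) with (y ^ 2) by ring.
    rewrite sqrt_pow2 by lra. lra.
Qed.

Lemma ln_sqrt_sum_sq_le (d y : R) : 0 < d -> 0 < y <= 1 -> ln (sqrt (d ^ 2 + y ^ 2)) <= ln (d + 1).
Proof.
  intros Hd Hy. apply ln_le.
  - apply sqrt_lt_R0. now apply sum_sq_pos.
  - rewrite <- (sqrt_pow2 (d + 1)) by lra. apply sqrt_le_1_alt. nra.
Qed.

Lemma sqrt_flow_boundary (al A B t x : R) : 0 < al < 1 -> B < A -> 0 < t ->
  B * sqrt t <= x <= A * sqrt t ->
  slit_image (sqrt_flow al A B) (sqrt_slit al A B) t x.
Proof.
  intros Hal HAB Ht Hx. assert (P := sqrt_lt_R0 t Ht).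
  assert (Hd : 0 < (A - B) * sqrt t) by nra.
  destruct (proj1 Hx) as [Hx1|Hx1]; [destruct (proj2 Hx) as [Hx2|Hx2]|].
  - now apply sqrt_flow_boundary_interior.
  - apply (sqrt_flow_boundary_end al A B t x al (1 - al)); auto; try lra.
    intros y Hy. rewrite Re_log_mean, !Cmod_real_shift, Hx2.
    replace ((A * sqrt t - A * sqrt t) ^ 2 + y ^ 2) with (y ^ 2) by ring.
    replace (A * sqrt t - B * sqrt t) with ((A - B) * sqrt t) by ring.
    rewrite sqrt_pow2 by lra.
    assert (Q := ln_sqrt_sum_sq_le _ y Hd Hy). nra.
  - apply (sqrt_flow_boundary_end al A B t x (1 - al) al); auto; try lra.
    intros y Hy. rewrite Re_log_mean, !Cmod_real_shift, <- Hx1.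
    replace ((B * sqrt t - B * sqrt t) ^ 2 + y ^ 2) with (y ^ 2) by ring.
    replace ((B * sqrt t - A * sqrt t) ^ 2) with (((A - B) * sqrt t) ^ 2) by ring.
    rewrite sqrt_pow2 by lra.
    assert (Q := ln_sqrt_sum_sq_le _ y Hd Hy). nra.
Qed.

Lemma singular_growth_sharp (J : R -> Prop) (c M : R) : time_interval J -> 0 <= c ->
  singular_growth_bound J c M -> (c + sqrt (c ^ 2 + 16)) / 2 <= M.
Proof.
  intros [HJ0 [[T0 [HT0 HJT]] [HJpos HJ]]] Hc HB.
  assert (Hs : 0 < sqrt (c ^ 2 + 16)) by (apply sqrt_lt_R0; nra).
  assert (Hs2 : sqrt (c ^ 2 + 16) * sqrt (c ^ 2 + 16) = c ^ 2 + 16) by (apply sqrt_sqrt; nra).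
  set (A := (c + sqrt (c ^ 2 + 16)) / 2).
  set (B := (c - sqrt (c ^ 2 + 16)) / 2).
  assert (HA : 0 < A) by (unfold A; lra).
  assert (Hsum : A + B = c) by (unfold A, B; lra).
  assert (Hprod : A * B = - 4) by (unfold A, B; nra).
  assert (HB0 : B < 0) by nra.
  assert (HAB : B < A) by lra.
  set (al := - B / (A - B)).
  assert (Hal : 0 < al < 1).
  { unfold al. split; [apply Rdiv_lt_0_compat; lra|]. apply Rlt_div_l; lra. }
  assert (Hmean : al * A + (1 - al) * B = 0) by (unfold al; field; lra).
  pose (lam := fun s => (A + B) * sqrt s).
  assert (Hlam0 : lam 0 = 0) by (unfold lam; rewrite sqrt_0; ring).
  assert (Hbar : Rbar_le (Finite A)
    (limsup_right (fun t : R => (A * sqrt t - A * sqrt 0) / sqrt t) 0)).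
  { apply le_limsup_right. intros t Ht. rewrite sqrt_0. right. field.
    apply Rgt_not_eq, sqrt_lt_R0, Ht. }
  change (Rbar_le (Finite A) (Finite M)).
  eapply Rbar_le_trans; [exact Hbar|].
  apply (HB lam (sqrt_flow al A B) (sqrt_slit al A B) (fun t => B * sqrt t) (fun t => A * sqrt t)).
  - split.
    + intros s t HJs HJt. unfold lam. rewrite Hsum, <- Rmult_minus_distr_l, Rabs_mult.
      rewrite (Rabs_pos_eq c Hc). apply Rmult_le_compat_l; [exact Hc|].
      apply sqrt_half_holder; auto.
    + intros K HK. specialize (HK 0 T0 HJ0 HJT). rewrite Hlam0 in HK.
      unfold lam in HK. rewrite Hsum, !Rminus_0_r in HK.
      assert (P := sqrt_lt_R0 T0 HT0).
      rewrite !Rabs_pos_eq in HK by (try lra; nra).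
      apply (Rmult_le_reg_r (sqrt T0)); assumption.
  - intros t _ Ht. rewrite Hlam0. split; [now apply sqrt_slit_jordan|split].
    + intros z Hz. now apply sqrt_flow_loewner.
    + now apply sqrt_flow_conformal.
  - intros t _ Ht. rewrite Hlam0. now apply sqrt_slit_quasislit.
  - split; [|split].
    + rewrite Hlam0, sqrt_0. ring.
    + rewrite Hlam0, sqrt_0. ring.
    + intros t _ Ht. assert (P := sqrt_lt_R0 t Ht). split; [nra|].
      intros x. split; [|now apply sqrt_flow_boundary].
      intros Hx.
      assert (Hj : jordan_slit (lam 0) (sqrt_slit al A B t)) by (rewrite Hlam0; now apply sqrt_slit_jordan).
      assert (Hsol : forall z, slit_domain (sqrt_slit al A B t) z ->
        loewner_solution lam z t (sqrt_flow al A B z)).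
      { intros z Hz. now apply sqrt_flow_loewner. }
      assert (U1 := slit_image_bound 1 A (A + B) t lam _ _ x ltac:(ring) Ht HA ltac:(nra)
        ltac:(intros s Hst; rewrite Hlam0; unfold lam; right; ring) Hj Hsol Hx).
      assert (U2 := slit_image_bound (-1) (- B) (- (A + B)) t lam _ _ x ltac:(ring) Ht ltac:(lra)
        ltac:(nra) ltac:(intros s Hst; rewrite Hlam0; unfold lam; right; ring) Hj Hsol Hx).
      rewrite Hlam0 in U1, U2. lra.
Qed.

Theorem theorem3p1 (J : R -> Prop) (c : R) (HJ : time_interval J) :
  singular_growth_bound J c ((c + sqrt (c ^ 2 + 16)) / 2) /\
  (0 <= c -> forall B : R, singular_growth_bound J c B ->
     (c + sqrt (c ^ 2 + 16)) / 2 <= B).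
Proof.
  split.
  - now apply singular_growth_upper.
  - intros Hc B. now apply singular_growth_sharp.
Qed.
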